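(* Let $\varphi:\mathbb R\to\mathbb R$ be a function. Then $$\overline{\mathcal N_\varphi^1(\mathbb R)}\cap C_0(\mathbb R)\ne\{0\}$$ if and only if for all $n,l\in\mathbb N$ we have $$C_0(\mathbb R^n)\subseteq\overline{\mathcal N_\varphi^l(\mathbb R^n)}.$$
   Context: $\mathbb N=\{1,2,\ldots\}$. $C_0(\mathbb R^n)$ is the space of continuous functions $f:\mathbb R^n\to\mathbb R$ with $\lim_{\|x\|\to\infty}f(x)=0$. For an arbitrary function $\varphi:\mathbb R\to\mathbb R$ define the real vector spaces of functions $\mathbb R^n\to\mathbb R$ $$\mathcal N_\varphi^1(\mathbb R^n):=\operatorname{span}\{x\mapsto\varphi(a\cdot x+b)\mid a\in\mathbb R^n,\ b\in\mathbb R\},$$ and, recursively for $l\ge2$, $$\mathcal N_\varphi^l(\mathbb R^n):=\operatorname{span}\{x\mapsto\varphi(f(x)+b)\mid f\in\mathcal N_\varphi^{l-1}(\mathbb R^n),\ b\in\mathbb R\},$$ where span is the $\mathbb R$-linear span and $a\cdot x$ is the Euclidean inner product. For a set $S$ of functions $\mathbb R^n\to\mathbb R$ (possibly unbounded), $\overline S$ is its uniform closure: $h\in\overline S$ iff for every $\epsilon>0$ there is $s\in S$ with $\sup_{x\in\mathbb R^n}|h(x)-s(x)|<\epsilon$. *)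

(* Defs.v *)
From mathcomp Require Import all_boot all_order all_algebra.
From mathcomp Require Import all_classical all_reals all_analysis.

Set Implicit Arguments.
Unset Strict Implicit.
Unset Printing Implicit Defensive.

Import Order.TTheory GRing.Theory Num.Theory.
Import numFieldNormedType.Exports.

Local Open Scope classical_set_scope.
Local Open Scope ring_scope.

Definition dot (R : realType) (n : nat) (a x : 'rV[R]_n) : R :=
  \sum_(i < n) a ord0 i * x ord0 i.

(* The library norm on 'rV[R]_n is the maximum norm. *)
Definition enorm (R : realType) (n : nat) (x : 'rV[R]_n) : R :=
  Num.sqrt (dot x x).

(* The filter "||x|| --> oo". *)
Definition at_infinity (R : realType) (n : nat) : set_system 'rV[R]_n :=
  filter_from [set: R] (fun M => [set x | M < enorm x]).
Arguments at_infinity : clear implicits.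

Definition C0 (R : realType) (n : nat) : set ('rV[R]_n -> R) :=
  [set f | continuous f /\ f @ at_infinity R n --> (0 : R)].
Arguments C0 : clear implicits.

Definition lin_span (R : realType) (T : Type) (S : set (T -> R)) :
    set (T -> R) :=
  [set h | exists (k : nat) (c : 'I_k -> R) (g : 'I_k -> T -> R),
     (forall i, S (g i)) /\ h = (fun x => \sum_(i < k) c i * g i x)].

(* The supremum is taken in \bar R because the functions may be unbounded. *)
Definition unif_closure (R : realType) (T : Type) (S : set (T -> R)) :
    set (T -> R) :=
  [set h | forall e : R, 0 < e -> exists2 s, S s &
     (ereal_sup [set `|h x - s x|%:E | x in [set: T]] < e%:E)%E].

(* [NN phi n l] is the space with l hidden layers, for l >= 1; its value at
   l = 0 is a dummy. *)
Fixpoint NN (R : realType) (phi : R -> R) (n l : nat) :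
    set ('rV[R]_n -> R) :=
  match l with
  | 0 => set0
  | 1 => lin_span [set (fun x => phi (dot a x + b)) |
                    a in [set: 'rV[R]_n] & b in [set: R]]
  | l'.+1 => lin_span [set (fun x => phi (f x + b)) |
                        f in @NN R phi n l' & b in [set: R]]
  end.
Arguments NN {R} phi n l.

(* Main.v *)
Require Import Defs.
From mathcomp Require Import all_boot all_order all_algebra.
From mathcomp Require Import all_classical all_reals all_analysis.
From mathcomp Require Import ring lra zify.
Import Order.TTheory GRing.Theory Num.Theory.
Import numFieldNormedType.Exports.
Local Open Scope classical_set_scope.
Local Open Scope ring_scope.

Set Implicit Arguments.
Unset Strict Implicit.
Unset Printing Implicit Defensive.

(** The heart of the matter is one-dimensional: a uniformly closed space V of
functions on R that is stable under affine substitutions and contains a nonzero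
psi in C_0(R) contains all of C_0(R). Smoothing psi twice by a short box gives
theta in C_0(R), with a positive maximum at some x0 (up to a sign), whose second
derivative is a second difference of psi, hence lies in V. Then
K(y) = (2 theta(x0) - theta(x0 + y) - theta(x0 - y)) / y^2 is nonnegative and
integrable, and it is minus the mean of theta''(x0 + (s - t) y) over
0 <= s, t <= 1. The Riemann sums of this mean converge uniformly on R: when y is
small compared with the number of nodes because theta'' is uniformly continuous,
otherwise because few nodes fall where theta'' is not small. So K is in V, and
its dilates form an approximate identity.

For l = 1 and n variables, let p(t) = t / (1 + t^2). The mean of p' over the
segment from v to u is (p(u) - p(v)) / (u - v) = (1 - u v) / ((1 + u^2) (1 + v^2)),
and again its Riemann sums converge uniformly on R^2; replacing v by - v and
adding yields 2 / ((1 + u^2) (1 + v^2)). By density in one variable, applied to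
each factor, all products of ridge functions g(a.x + b) with g in C_0(R) are in
the closure, in particular the tensor products of tents, which approximate
C_0(R^n).

For l > 1, the closure contains g o f for g in C_0(R) and f in the closure of
the previous layer; take g equal to the identity on the range of f. *)

(** * Closed subspaces, C_0(R) and primitives on the line *)

Definition closed_subspace (R : realType) (T : Type) (V : set (T -> R)) : Prop :=
  [/\ V (fun=> 0),
      forall f g, V f -> V g -> V (fun x => f x + g x),
      forall (c : R) f, V f -> V (fun x => c * f x) &
      forall f, (forall e : R, 0 < e ->
        exists2 s, V s & forall x, `|f x - s x| <= e) -> V f].

Definition affine_stable (R : realType) (V : set (R -> R)) : Prop :=
  forall f (a b : R), V f -> V (fun t => f (a * t + b)).

Definition bdd (R : realType) (T : Type) (f : T -> R) : Prop :=
  exists B : R, forall x, `|f x| <= B.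

Definition ucont (R : realType) (f : R -> R) : Prop :=
  forall e : R, 0 < e -> exists2 d : R, 0 < d &
    forall x y, `|x - y| <= d -> `|f x - f y| <= e.

Definition vanishing (R : realType) (f : R -> R) : Prop :=
  forall e : R, 0 < e -> exists2 L : R, 0 <= L & forall x, L < `|x| -> `|f x| <= e.

(** C_0(R) in the epsilon form that the estimates use; [C0_1_c0] derives it from the topological
    definition. *)
Definition c0 (R : realType) (f : R -> R) : Prop :=
  [/\ bdd f, ucont f & vanishing f].

Definition primitive (R : realType) (F f : R -> R) : Prop :=
  forall x, is_derive x (1 : R) F (f x).

Lemma primitive_continuous (R : realType) (F f : R -> R) :
  primitive F f -> continuous F.
Proof.
move=> Ff x; apply: differentiable_continuous; apply/derivable1_diffP.
exact: (@ex_derive _ _ _ _ _ _ _ (Ff x)).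
Qed.

Lemma primitive_mvt (R : realType) (F f : R -> R) : primitive F f ->
  forall a b : R, exists2 c : R, F b - F a = f c * (b - a) & `|c - a| <= `|b - a|.
Proof.
move=> Ff a b; have cF := primitive_continuous Ff.
have sub (u v : R) : {within `[u, v], continuous F}.
  exact: continuous_subspaceT.
have [ab|/ltW ba] := leP a b.
- have [c cab E] := MVT_segment ab (fun x _ => Ff x) (sub a b).
  exists c => //; move: cab; rewrite in_itv /= => /andP[h1 h2].
  by rewrite !ger0_norm; lra.
- have [c cab E] := MVT_segment ba (fun x _ => Ff x) (sub b a).
  exists c; first by rewrite -opprB E; ring.
  move: cab; rewrite in_itv /= => /andP[h1 h2].
  by rewrite !ler0_norm; lra.
Qed.

Lemma primitiveB (R : realType) (F f G g : R -> R) :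
  primitive F f -> primitive G g ->
  primitive (fun x => F x - G x) (fun x => f x - g x).
Proof.
by move=> Ff Gg x; have := Ff x; have := Gg x => ? ?; exact: is_deriveB.
Qed.

Lemma primitive_affine (R : realType) (F f : R -> R) (a b : R) :
  primitive F f -> primitive (fun x => F (a * x + b)) (fun x => a * f (a * x + b)).
Proof.
move=> Ff x.
have h : is_derive x (1 : R) ((a \*: (id : R -> R)) + cst b) (a *: 1 + 0).
  by apply: is_deriveD; apply: is_deriveZ.
rewrite addr0 [a *: 1]mulr1 in h.
have := @is_derive1_comp _ F (fun x : R => a * x + b) x _ _ (Ff (a * x + b)) h.
by rewrite mulrC.
Qed.

(** * Uniform convergence of Riemann sums *)

(** Each increment of [q] equals [s * q' c] with [c] within [d] of the node, so each node costs at
    most [|s| * e]. Only one pair [(e, d)] is assumed, which later lets [e] depend on [y]. *)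
Lemma riemann_sum_error (R : realType) (q q' : R -> R) (e d : R) :
  primitive q q' -> (forall a b, `|a - b| <= d -> `|q' a - q' b| <= e) ->
  forall (z s : R) (N : nat), `|s| <= d ->
  `|q (z + N%:R * s) - q z - s * \sum_(k < N) q' (z + k%:R * s)|
    <= N%:R * `|s| * e.
Proof.
move=> dq uq z s N sd; elim: N => [|N IH].
  by rewrite big_ord0 !mul0r addr0 mulr0 !subrr normr0.
rewrite big_ord_recr /=.
have [c E cle] := primitive_mvt dq (z + N%:R * s) (z + N.+1%:R * s).
have {}E : q (z + N.+1%:R * s) = q (z + N%:R * s) + s * q' c.
  by move/eqP: E; rewrite subr_eq -natr1 => /eqP ->; ring.
have {}cle : `|c - (z + N%:R * s)| <= d.
  move: cle; rewrite -natr1 (_ : z + (N%:R + 1) * s - (z + N%:R * s) = s).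
    by move/le_trans; apply.
  by ring.
have h1 := uq _ _ cle.
rewrite E mulrDr -natr1.
have -> : q (z + N%:R * s) + s * q' c - q z - (s * (\sum_(k < N) q' (z + k%:R * s)) + s * q' (z + N%:R * s))
 = (q (z + N%:R * s) - q z - s * \sum_(k < N) q' (z + k%:R * s)) + s * (q' c - q' (z + N%:R * s)) by ring.
apply: le_trans (ler_normD _ _) _.
have -> : (N%:R + 1) * `|s| * e = N%:R * `|s| * e + `|s| * e by ring.
by rewrite lerD // normrM ler_wpM2l.
Qed.

Lemma sum_itv_nat (a b N : nat) :
  (\sum_(k < N) ((a <= k) && (k < b) : nat) <= minn N b - a)%N.
Proof.
elim: N => [|N IH]; first by rewrite big_ord0.
rewrite big_ord_recr /=.
by apply: leq_trans (leq_add IH (leqnn _)) _; case: (leqP a N) => ? /=; case: (ltnP N b) => ? /=; lia.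
Qed.

(** The set [P] lies in a window of [m + 1] integers that begins at its least element. *)
Lemma sum_clustered_nat (P : pred nat) (N m : nat) :
  (forall i j, P i -> P j -> (i <= j)%N -> (j - i <= m)%N) ->
  (\sum_(k < N) (P k : nat) <= m.+1)%N.
Proof.
move=> HP; have [[i Pi]|noP] := pselect (exists i, P i); last first.
  rewrite big1 // => k _; case: (boolP (P k)) => // Pk.
  by case: noP; exists k.
have exP : exists i, P i by exists i.
case: (ex_minnP exP) => c Pc cmin.
apply: leq_trans (_ : (\sum_(k < N) ((c <= k) && (k < c + m.+1) : nat) <= _)%N).
  apply: leq_sum => k _; case: (boolP (P k)) => // Pk.
  rewrite (cmin _ Pk) /=; have := HP _ _ Pc Pk (cmin _ Pk).
  by case: ltnP => //; lia.
by apply: leq_trans (sum_itv_nat _ _ _) _; lia.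
Qed.

(* At most [2 L / d + 2] of the nodes [z + k s] fall in [-L, L]. *)
Lemma sparse_sum_le (R : realType) (f : R -> R) (B e L d : R) :
  (forall x, `|f x| <= B) -> 0 <= e -> (forall x, L < `|x| -> `|f x| <= e) ->
  0 < d ->
  exists m : nat, forall (z s : R) (N : nat), d <= `|s| ->
    `|\sum_(k < N) f (z + k%:R * s)| <= m%:R * B + N%:R * e.
Proof.
move=> fB e0 fL d0; exists (Num.bound (2 * L / d)).+1 => z s N ds.
set m := Num.bound _.
pose P k := `|z + k%:R * s| <= L.
have B0 : 0 <= B by apply: le_trans (fB 0).
apply: le_trans (ler_norm_sum _ _ _) _.
apply: le_trans (_ : \sum_(k < N) ((P k : nat)%:R * B + e) <= _).
  apply: ler_sum => k _; rewrite /P; case: (leP `|_| L) => h.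
    by rewrite mul1r; apply: le_trans (fB _) _; rewrite lerDl.
  by rewrite mul0r add0r fL.
rewrite big_split /= -mulr_suml -natr_sum sumr_const card_ord -[e *+ N]mulr_natl lerD2r.
apply: ler_wpM2r => //; rewrite ler_nat; apply: sum_clustered_nat => i j Pi Pj ij.
have h : (j - i)%:R * d <= 2 * L.
  have -> : 2 * L = L + L by ring.
  apply: le_trans (lerD Pj Pi); rewrite -[`|z + i%:R * s|]normrN.
  apply: le_trans (ler_normD _ _).
  have -> : z + j%:R * s + - (z + i%:R * s) = (j - i)%:R * s by rewrite natrB //; ring.
  by rewrite normrM normr_nat ler_wpM2l.
have h2 : (j - i)%:R <= 2 * L / d by rewrite ler_pdivlMr.
rewrite -(ler_nat R); apply: (le_trans h2); apply/ltW/archi_boundP.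
by apply: le_trans h2.
Qed.

Lemma exists_nat_mul_ge (R : realType) (A B e : R) : 0 < e ->
  exists2 N : nat, (0 < N)%N & A <= N%:R * e /\ B <= N%:R * e.
Proof.
move=> e0; exists (Num.bound (`|A| / e) + Num.bound (`|B| / e)).+1 => //.
have h (C : R) : C <= (Num.bound (`|C| / e))%:R * e.
  rewrite -ler_pdivrMr //; apply: le_trans (ltW (archi_boundP _)).
    by rewrite ler_pM2r ?invr_gt0 // ler_norm.
  by rewrite divr_ge0 // ltW.
by split; apply: (le_trans (h _)); rewrite ler_pM2r // ler_nat; lia.
Qed.

Lemma ler_norm3D (R : realType) (a b c e : R) :
  `|a| <= e -> `|b| <= e -> `|c| <= e -> `|a + b + c| <= 3 * e.
Proof.
move=> ha hb hc; have h1 := ler_normD (a + b) c; have h2 := ler_normD a b.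
by lra.
Qed.

(** With step [s = y / N]: if [|s| <= d], the uniform continuity of [p'] controls the sum. Otherwise
    [|y| >= N d], so the quotient is small because [p] is bounded, and the sum is small because
    boundedly many nodes lie in [-L, L]. Hence one [N] serves all [x] and [y]. *)
Lemma divided_difference_lim (R : realType) (p p' : R -> R) :
  primitive p p' -> bdd p -> c0 p' ->
  forall e : R, 0 < e -> exists2 N : nat, (0 < N)%N & forall x y : R,
  `|(if y == 0 then p' x else (p (x + y) - p x) / y)
    - N%:R^-1 * \sum_(k < N) p' (x + k%:R * (y / N%:R))| <= e.
Proof.
move=> dp [B pB] [[B' pB'] up vp] e e0.
have e30 : 0 < e / 3 by lra.
have [d d0 ud] := up _ e30; have [L L0 vL] := vp _ e30.
have [m hm] := sparse_sum_le pB' (ltW e30) vL d0.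
have B0 : 0 <= B by apply: le_trans (pB 0).
have [N N0 [hN1 hN2]] := @exists_nat_mul_ge R (2 * B / d) (m%:R * B') (e / 3) e30.
have NR0 : 0 < N%:R :> R by rewrite ltr0n.
exists N => // x y; have [->|y0] := eqVneq y 0.
  rewrite (eq_bigr (fun=> p' x)) => [|k _]; last by rewrite mul0r mulr0 addr0.
  rewrite sumr_const card_ord -[p' x *+ N]mulr_natl mulKf ?subrr ?normr0 ?ltW //.
  by rewrite gt_eqF.
set s := y / N%:R; have yE : y = N%:R * s by rewrite /s mulrC divfK // gt_eqF.
clearbody s.
have s0 : s != 0 by apply: contra_neq y0 => s0; rewrite yE s0 mulr0.
have ns0 : 0 < `|s| by rewrite normr_gt0.
have [sd|/ltW ds] := leP `|s| d.
  have := riemann_sum_error dp ud x N sd; rewrite -yE => h.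
  apply: (@le_trans _ _ (e / 3)); last by lra.
  have -> : (p (x + y) - p x) / y - N%:R^-1 * \sum_(k < N) p' (x + k%:R * s)
    = (p (x + y) - p x - s * \sum_(k < N) p' (x + k%:R * s)) / y.
    rewrite [in RHS]mulrBl; congr (_ - _); rewrite yE; field.
    by rewrite s0 gt_eqF.
  rewrite normrM normfV ler_pdivrMr ?normr_gt0 //; apply: (le_trans h).
  by rewrite yE normrM normr_nat mulrC.
have h1 : `|(p (x + y) - p x) / y| <= e / 3.
  rewrite normrM normfV ler_pdivrMr ?normr_gt0 //.
  apply: (@le_trans _ _ (2 * B)).
    by have := ler_normB (p (x + y)) (p x); have := pB (x + y); have := pB x; lra.
  rewrite yE normrM normr_nat.
  have h : 2 * B <= N%:R * (e / 3) * d by rewrite -ler_pdivrMr.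
  apply: (le_trans h).
  rewrite (_ : e / 3 * (N%:R * `|s|) = N%:R * (e / 3) * `|s|); last by ring.
  by rewrite ler_pM2l // mulr_gt0.
have h2 : `|N%:R^-1 * \sum_(k < N) p' (x + k%:R * s)| <= 2 * (e / 3).
  rewrite normrM normfV normr_nat mulrC ler_pdivrMr //.
  by apply: (le_trans (hm _ _ _ ds)); lra.
by have := ler_normB ((p (x + y) - p x) / y) (N%:R^-1 * \sum_(k < N) p' (x + k%:R * s)); lra.
Qed.

(** As th'' = f, the quotient is the mean of f(x0 + (s - t) y) over the unit square. The cases are
    those of [divided_difference_lim], with two nested sums. *)
Lemma second_difference_lim (R : realType) (th p f : R -> R) (x0 : R) :
  primitive th p -> primitive p f -> bdd th -> c0 f ->
  forall e : R, 0 < e -> exists2 N : nat, (0 < N)%N & forall y : R,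
  `|(if y == 0 then f x0 else (th (x0 + y) - 2 * th x0 + th (x0 - y)) / y ^+ 2)
    - N%:R^-2 * \sum_(j < N) \sum_(k < N) f (x0 + (j%:R - k%:R) * (y / N%:R))| <= e.
Proof.
move=> dth dp [B thB] [[B' fB'] uf vf] e e0.
have e30 : 0 < e / 3 by lra.
have [d d0 ud] := uf _ e30; have [L L0 vL] := vf _ e30.
have [m hm] := sparse_sum_le fB' (ltW e30) vL d0.
have B0 : 0 <= B by apply: le_trans (thB 0).
(* Here [4 * B] bounds the second difference of [th], and [m%:R * B'] the contribution of the nodes
   of one row that lie in [-L, L]. *)
have [N N0 [hN1 hN2]] := @exists_nat_mul_ge R (4 * B / d ^+ 2) (m%:R * B') (e / 3) e30.
have NR0 : 0 < N%:R :> R by rewrite ltr0n.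
have NR1 : 1 <= N%:R :> R by rewrite ler1n.
exists N => // y; have [->|y0] := eqVneq y 0.
  rewrite (eq_bigr (fun=> N%:R * f x0)) => [|j _]; last first.
    rewrite (eq_bigr (fun=> f x0)) => [|k _]; last by rewrite mul0r mulr0 addr0.
    by rewrite sumr_const card_ord mulr_natl.
  rewrite sumr_const card_ord -[N%:R * f x0 *+ N]mulr_natl mulrA -expr2 mulKf ?subrr ?normr0 ?ltW //.
  by rewrite expf_neq0 // gt_eqF.
set s := y / N%:R; have yE : y = N%:R * s by rewrite /s mulrC divfK // gt_eqF.
clearbody s.
have s0 : s != 0 by apply: contra_neq y0 => s0; rewrite yE s0 mulr0.
have ns0 : 0 < `|s| by rewrite normr_gt0.
have y2 : `|y ^+ 2| = `|y| * `|y| by rewrite expr2 normrM.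
have ny0 : 0 < `|y| by rewrite normr_gt0.
have yN : `|y| = N%:R * `|s| by rewrite yE normrM normr_nat.
under eq_bigr do under eq_bigr do rewrite mulrBl addrA -mulrN.
have [sd|/ltW ds] := leP `|s| d.
  (* The second difference of [th] is [r (x0 + y) - r x0], a first difference of [r]. *)
  pose r z := th z - th (z - y); pose r' z := p z - p (z - y).
  have dr : primitive r r'.
    apply: (primitiveB dth); have := primitive_affine 1 (- y) dth.
    by under eq_fun do rewrite mul1r; under [X in primitive _ X]eq_fun do rewrite !mul1r.
  (* The mean value theorem for [g] between 0 and [y] gives the oscillation of [r'] a factor [|y|];
     the division by [y ^+ 2] requires it. *)
  have ur a b : `|a - b| <= d -> `|r' a - r' b| <= `|y| * (e / 3).
    move=> ab; pose g t := p (a - t) - p (b - t).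
    have dg : primitive g (fun t => f (b - t) - f (a - t)).
      have h (u : R) : primitive (fun t => p (u - t)) (fun t => - f (u - t)).
        have := primitive_affine (-1) u dp.
        by under eq_fun do rewrite mulN1r addrC; under [X in primitive _ X]eq_fun do rewrite !mulN1r addrC.
      have := primitiveB (h a) (h b).
      by under [X in primitive _ X -> _]eq_fun do rewrite opprK addrC.
    have [c E _] := primitive_mvt dg 0 y.
    have -> : r' a - r' b = - (g y - g 0) by rewrite /r' /g !subr0; ring.
    rewrite E normrN normrM subr0 mulrC ler_wpM2l // ud //.
    by apply: le_trans ab; rewrite distrC (_ : a - c - (b - c) = a - b) //; ring.
  have h1 := riemann_sum_error dr ur x0 N sd.
  have sd' : `|- s| <= d by rewrite normrN.
  have h2 (j : 'I_N) : `|r' (x0 + j%:R * s) - s * \sum_(k < N) f (x0 + j%:R * s + k%:R * - s)| <= `|y| * (e / 3).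
    have := riemann_sum_error dp ud (x0 + j%:R * s) N sd'.
    rewrite mulrN -yE normrN -yN mulNr opprK => h.
    move: h; rewrite /r'; set z := x0 + _; set S := \sum_(_ < _) _ => h.
    by rewrite -normrN (_ : - (p z - p (z - y) - s * S) = p (z - y) - p z + s * S) //; ring.
  have h3 : `|r (x0 + y) - r x0 - s * \sum_(j < N) s * \sum_(k < N) f (x0 + j%:R * s + k%:R * - s)|
      <= `|y| * `|y| * (2 * (e / 3)).
    (* [A] is the error of the outer sum and [s * D] that of the inner sums; each is at most |y|^2 e
       / 3, as N |s| = |y|. *)
    pose A := r (x0 + N%:R * s) - r x0 - s * \sum_(j < N) r' (x0 + j%:R * s).
    pose D := \sum_(j < N) (r' (x0 + j%:R * s) - s * \sum_(k < N) f (x0 + j%:R * s + k%:R * - s)).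
    have -> : r (x0 + y) - r x0 - s * \sum_(j < N) s * \sum_(k < N) f (x0 + j%:R * s + k%:R * - s) = A + s * D.
      have -> : D = \sum_(j < N) r' (x0 + j%:R * s)
          - \sum_(j < N) s * \sum_(k < N) f (x0 + j%:R * s + k%:R * - s) by exact: sumrB.
      by rewrite /A -yE; ring.
    have hD : `|D| <= N%:R * (`|y| * (e / 3)).
      apply: (le_trans (ler_norm_sum _ _ _)).
      rewrite mulr_natl -[N in _ *+ N]card_ord -sumr_const.
      by apply: ler_sum => j _; exact: h2.
    have hs : `|s * D| <= `|y| * `|y| * (e / 3).
      rewrite normrM {1}yN (_ : N%:R * `|s| * `|y| * (e / 3) = `|s| * (N%:R * (`|y| * (e / 3)))); last by ring.
      by rewrite ler_pM2l.
    have := ler_normD A (s * D); move: h1; rewrite -/A -yN mulrA; lra.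
  have -> : (th (x0 + y) - 2 * th x0 + th (x0 - y)) / y ^+ 2
      - N%:R^-2 * \sum_(j < N) \sum_(k < N) f (x0 + j%:R * s + k%:R * - s)
    = (r (x0 + y) - r x0 - s * \sum_(j < N) s * \sum_(k < N) f (x0 + j%:R * s + k%:R * - s)) / y ^+ 2.
    rewrite -mulr_sumr [in RHS]mulrBl; congr (_ - _).
      by rewrite /r addrK; congr (_ / _); ring.
    by rewrite yE; field; rewrite s0 gt_eqF.
  rewrite normrM normfV y2 ler_pdivrMr ?mulr_gt0 //; apply: (le_trans h3).
  by rewrite mulrC ler_pM2r ?mulr_gt0 //; lra.
have h1 : `|(th (x0 + y) - 2 * th x0 + th (x0 - y)) / y ^+ 2| <= e / 3.
  rewrite normrM normfV ler_pdivrMr ?normr_gt0 ?expf_neq0 //.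
  apply: (@le_trans _ _ (4 * B)).
    have := thB (x0 + y); have := thB x0; have := thB (x0 - y).
    rewrite !ler_norml => /andP[? ?] /andP[? ?] /andP[? ?].
    by apply/andP; split; lra.
  rewrite ler_pdivrMr ?exprn_gt0 // in hN1; apply: (le_trans hN1).
  rewrite y2 yN (_ : e / 3 * (N%:R * `|s| * (N%:R * `|s|)) = N%:R * (e / 3) * (N%:R * `|s| ^+ 2)); last by ring.
  rewrite ler_pM2l ?mulr_gt0 //; apply: (@le_trans _ _ (`|s| ^+ 2)).
    by rewrite ler_pXn2r ?nnegrE // ltW.
  by rewrite ler_peMl ?exprn_ge0.
have h2 : `|N%:R^-2 * \sum_(j < N) \sum_(k < N) f (x0 + j%:R * s + k%:R * - s)| <= 2 * (e / 3).
  have ds' : d <= `|- s| by rewrite normrN.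
  rewrite normrM normfV normrX normr_nat mulrC ler_pdivrMr ?exprn_gt0 //.
  apply: (le_trans (ler_norm_sum _ _ _)).
  apply: (@le_trans _ _ (\sum_(j < N) (m%:R * B' + N%:R * (e / 3)))).
    by apply: ler_sum => j _; exact: hm.
  rewrite sumr_const card_ord -[_ *+ N in leLHS](mulr_natl (m%:R * B' + N%:R * (e / 3))).
  rewrite (_ : 2 * (e / 3) * N%:R ^+ 2 = N%:R * (N%:R * (e / 3) + N%:R * (e / 3))); last by ring.
  by rewrite ler_pM2l // lerD2r.
by have := ler_normB ((th (x0 + y) - 2 * th x0 + th (x0 - y)) / y ^+ 2) (N%:R^-2 * \sum_(j < N) \sum_(k < N) f (x0 + j%:R * s + k%:R * - s)); lra.
Qed.

(** * Primitives of continuous functions *)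

Lemma continuous_primitive (R : realType) (f : R -> R) :
  continuous f -> exists F, primitive F f.
Proof.
move=> cf; pose mu := @lebesgue_measure R.
have int (a b : R) : mu.-integrable `[a, b] (EFin \o f).
  apply: continuous_compact_integrable; first exact: segment_compact.
  exact: continuous_subspaceT.
(* The base point 0 makes [F] global; near a given [x] it differs by a constant from [G], whose base
   point [- M] lies to the left of both [x] and 0. *)
pose F (x : R) := if 0 <= x then (\int[mu]_(t in `]0, x]) f t)%R
                  else - (\int[mu]_(t in `]x, 0]) f t)%R.
exists F; suff: forall x : R, is_derive x (1 : R) F (f x) by [].
move=> x; pose M := `|x| + 1.
pose G (y : R) := (\int[mu]_(t in `[- M, y]) f t)%R.
have M0 : 0 < M by rewrite /M ltr_pwDr.
have xM : - M < x by rewrite /M; have := ler_norm (- x); rewrite normrN; lra.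
have FG (y : R) : - M < y -> F y = G y - G 0.
  move=> My; rewrite /F /G; case: ifPn => [y0|].
    by rewrite Rintegral_itvB // bnd_simp //; lra.
  rewrite -ltNge => y0.
  by rewrite -opprB Rintegral_itvB // bnd_simp //; lra.
have [dG G'] : derivable G x 1 /\ derive1 G x = f x.
  by apply: (@continuous_FTC1_closed R f (- M) x (x + 1)) => //; [rewrite ltrDl|exact: cf].
have h1 : is_derive x (1 : R) G (f x) by apply: DeriveDef => //; rewrite -G' derive1E.
have h : is_derive x (1 : R) (fun y => G y - G 0) (f x - 0).
  exact: (is_deriveB h1 (is_derive_cst (G 0) x 1)).
rewrite subr0 in h; apply: near_eq_is_derive h.
near=> y; rewrite FG //.
near: y; exact: lt_nbhsr.
Unshelve. all: by end_near. Qed.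

Lemma ucont_continuous (R : realType) (f : R -> R) : ucont f -> continuous f.
Proof.
move=> uf x; apply/cvgrPdist_le => e e0; have [d d0 hd] := uf _ e0.
near=> t; apply: hd; near: t.
by apply: (cvgrPdist_le _ _).1 => //; exact: cvg_id.
Unshelve. all: by end_near. Qed.

(** * Operations on closed subspaces *)

Section ClosedSubspaces.
Context (R : realType) (T : Type) (V : set (T -> R)).
Hypothesis cV : closed_subspace V.

Lemma closed_subspaceZ c f : V f -> V (fun x => c * f x).
Proof. by case: cV => _ _ + _; apply. Qed.

Lemma closed_subspaceD f g : V f -> V g -> V (fun x => f x + g x).
Proof. by case: cV => _ + _ _; apply. Qed.

Lemma closed_subspaceN f : V f -> V (fun x => - f x).
Proof.
by move=> Vf; under eq_fun do rewrite -mulN1r; exact: closed_subspaceZ.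
Qed.

Lemma closed_subspaceB f g : V f -> V g -> V (fun x => f x - g x).
Proof. by move=> Vf Vg; apply: closed_subspaceD => //; exact: closed_subspaceN. Qed.

Lemma closed_subspace_sum (I : Type) (r : seq I) (F : I -> T -> R) :
  (forall i, V (F i)) -> V (fun x => \sum_(i <- r) F i x).
Proof.
move=> VF; elim: r => [|i r IH].
  by under eq_fun do rewrite big_nil; case: cV.
by under eq_fun do rewrite big_cons; exact: closed_subspaceD.
Qed.

Lemma closed_subspace_lim f : (forall e : R, 0 < e ->
  exists2 s, V s & forall x, `|f x - s x| <= e) -> V f.
Proof. by case: cV => _ _ _; apply. Qed.

End ClosedSubspaces.

(** As [phi] is arbitrary, a space containing it may have wild elements. Cutting down to bounded
    uniformly continuous functions leaves a closed subspace in which the Riemann sum arguments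
    apply. *)
Lemma closed_subspace_bdd_ucont (R : realType) (V : set (R -> R)) :
  closed_subspace V ->
  closed_subspace (V `&` [set f | bdd f /\ ucont f]).
Proof.
case=> V0 VD VZ Vl; split.
- split=> //; split; first by exists 0 => x; rewrite normr0.
  by move=> e e0; exists 1 => // x y _; rewrite subrr normr0 ltW.
- move=> f g [Vf [[B fB] uf]] [Vg [[C gC] ug]]; split; first exact: VD.
  split.
    by exists (B + C) => x; apply: (le_trans (ler_normD _ _)); rewrite lerD.
  move=> e e0; have e20 : 0 < e / 2 by lra.
  have [d d0 hd] := uf _ e20; have [d' d'0 hd'] := ug _ e20.
  exists (Num.min d d') => [|x y]; first by rewrite lt_min d0.
  rewrite le_min => /andP[/hd h1 /hd' h2].
  rewrite (_ : f x + g x - _ = f x - f y + (g x - g y)); last by ring.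
  by apply: (le_trans (ler_normD _ _)); lra.
- move=> c f [Vf [[B fB] uf]]; split; first exact: VZ.
  split; first by exists (`|c| * B) => x; rewrite normrM ler_wpM2l.
  move=> e e0; have c1 : 0 < `|c| + 1 by rewrite ltr_wpDl.
  have [d d0 hd] := uf (e / (`|c| + 1)) (divr_gt0 e0 c1).
  exists d => // x y /hd h; rewrite -mulrBr normrM.
  apply: (@le_trans _ _ ((`|c| + 1) * `|f x - f y|)).
    by rewrite ler_wpM2r // lerDl.
  by rewrite mulrC -ler_pdivlMr.
- move=> f hf; split.
    by apply: Vl => e /hf[s [Vs _] hs]; exists s.
  split.
    have [s [_ [[B sB] _]] hs] := hf 1 ltr01.
    exists (B + 1) => x; rewrite -[f x](subrK (s x)) addrC.
    by apply: (le_trans (ler_normD _ _)); rewrite lerD.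
  move=> e e0; have e30 : 0 < e / 3 by lra.
  have [s [_ [_ us]] hs] := hf _ e30; have [d d0 hd] := us _ e30.
  exists d => // x y /hd h.
  rewrite (_ : f x - f y = f x - s x + (s x - s y) + (s y - f y)); last by ring.
  have -> : e = 3 * (e / 3) by field.
  by apply: ler_norm3D => //; rewrite distrC.
Qed.

Lemma affine_stable_bdd_ucont (R : realType) (V : set (R -> R)) :
  affine_stable V -> affine_stable (V `&` [set f | bdd f /\ ucont f]).
Proof.
move=> aV f a b [Vf [[B fB] uf]]; split; first exact: aV.
split; first by exists B.
move=> e e0; have a1 : 0 < `|a| + 1 by rewrite ltr_wpDl.
have [d d0 hd] := uf _ e0; exists (d / (`|a| + 1)); first exact: divr_gt0.
move=> x y xy; apply: hd; rewrite (_ : _ - _ = a * (x - y)); last by ring.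
rewrite normrM; apply: (@le_trans _ _ ((`|a| + 1) * `|x - y|)).
  by rewrite ler_wpM2r // lerDl.
by rewrite mulrC -ler_pdivlMr.
Qed.

(** * Second differences, bounded increments and weighted means *)

(** If G'' = psi, this is psi smoothed twice by a box: the integral of psi(x + s + t) over 0 <= s, t
    <= h. Its second derivative is the second difference of psi itself. *)
Definition second_diff (R : realType) (G : R -> R) (h x : R) : R :=
  (G (x + h + h) - G (x + h)) - (G (x + h) - G x).

Lemma primitive_shift (R : realType) (F f : R -> R) (h : R) :
  primitive F f -> primitive (fun x => F (x + h)) (fun x => f (x + h)).
Proof.
move=> /(@primitive_affine _ _ _ 1 h).
by under eq_fun do rewrite mul1r; under [X in primitive _ X -> _]eq_fun do rewrite !mul1r.
Qed.

Lemma primitive_second_diff (R : realType) (F f : R -> R) (h : R) :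
  primitive F f -> primitive (second_diff F h) (second_diff f h).
Proof.
move=> Ff; have F1 := primitive_shift h Ff.
by apply: primitiveB; apply: primitiveB => //; exact: (primitive_shift h F1).
Qed.

Lemma second_diff_mvt (R : realType) (G F f : R -> R) (h x : R) :
  primitive G F -> primitive F f -> 0 < h ->
  exists2 c, second_diff G h x = h ^+ 2 * f c & `|c - x| <= 2 * h.
Proof.
move=> GF Ff h0.
have [c E cx] := primitive_mvt (primitiveB (primitive_shift h GF) GF) x (x + h).
have [c' E' cc] := primitive_mvt Ff c (c + h).
exists c'; first by rewrite /second_diff E E'; ring.
rewrite (_ : _ - _ = (c' - c) + (c - x)); last by ring.
apply: (le_trans (ler_normD _ _)).
by move: cc cx; rewrite [c + h]addrC [x + h]addrC !addrK (gtr0_norm h0); lra.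
Qed.

Lemma c0B (R : realType) (f g : R -> R) :
  c0 f -> c0 g -> c0 (fun x => f x - g x).
Proof.
move=> [[B fB] uf vf] [[C gC] ug vg]; split.
- by exists (B + C) => x; apply: (le_trans (ler_normB _ _)); rewrite lerD.
- move=> e e0; have e20 : 0 < e / 2 by lra.
  have [d d0 hd] := uf _ e20; have [d' d'0 hd'] := ug _ e20.
  exists (Num.min d d') => [|x y]; first by rewrite lt_min d0.
  rewrite le_min => /andP[/hd h1 /hd' h2].
  rewrite (_ : f x - g x - _ = f x - f y - (g x - g y)); last by ring.
  by apply: (le_trans (ler_normB _ _)); lra.
- move=> e e0; have e20 : 0 < e / 2 by lra.
  have [L L0 hL] := vf _ e20; have [M M0 hM] := vg _ e20.
  exists (L + M) => [|x xLM]; first exact: addr_ge0.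
  apply: (le_trans (ler_normB _ _)).
  have h1 := hL x; have h2 := hM x.
  have := h1 (le_lt_trans _ xLM); have := h2 (le_lt_trans _ xLM).
  by rewrite lerDl lerDr => /(_ L0) ? /(_ M0) ?; lra.
Qed.

Lemma c0_shift (R : realType) (f : R -> R) (h : R) :
  c0 f -> c0 (fun x => f (x + h)).
Proof.
move=> [[B fB] uf vf]; split; first by exists B.
- move=> e /uf[d d0 hd]; exists d => // x y xy; apply: hd.
  by rewrite (_ : _ - _ = x - y) //; ring.
- move=> e /vf[L L0 hL]; exists (L + `|h|) => [|x]; first exact: addr_ge0.
  move=> xL; apply: hL; have := ler_normB (x + h) h; rewrite addrK; lra.
Qed.

Lemma c0_second_diff (R : realType) (f : R -> R) (h : R) :
  c0 f -> c0 (second_diff f h).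
Proof.
by move=> f0; have f1 := c0_shift h f0; do !apply: c0B => //; exact: (c0_shift h f1).
Qed.

Lemma primitive_ler (R : realType) (F f : R -> R) :
  primitive F f -> (forall x, 0 <= f x) -> {homo F : a b / a <= b}.
Proof.
move=> Ff f0 a b ab; have [c E _] := primitive_mvt Ff a b.
by rewrite -subr_ge0 E mulr_ge0 // subr_ge0.
Qed.

(** The two bounds give K x <= (B + C) / (1 + x^2), so (B + C) atan - Q is nondecreasing and [Q]
    grows by at most (B + C) pi. *)
Lemma primitive_increments_bdd (R : realType) (Q K : R -> R) (B C : R) :
  primitive Q K -> (forall x, 0 <= K x) -> (forall x, K x <= B) -> (forall x, K x * x ^+ 2 <= C) ->
  exists M : R, forall a b, Q b - Q a <= M.
Proof.
move=> QK K0 KB KC; have BC x : K x * (1 + x ^+ 2) <= B + C.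
  by rewrite mulrDr mulr1 lerD.
have BC0 : 0 <= B + C.
  by apply: le_trans (BC 0); rewrite mulr_ge0 // addr_ge0 // sqr_ge0.
pose P x := (B + C) * atan x - Q x.
have dP : primitive P (fun x => (B + C) * (1 + x ^+ 2)^-1 - K x).
  apply: primitiveB QK => x.
  exact: (is_deriveZ (B + C) (is_derive1_atan x)).
have P0 x : 0 <= (B + C) * (1 + x ^+ 2)^-1 - K x.
  by rewrite subr_ge0 ler_pdivlMr // ltr_pwDl // sqr_ge0.
exists ((B + C) * pi) => a b; have [ab|/ltW ba] := leP a b; last first.
  apply: (@le_trans _ _ 0); first by rewrite subr_le0; apply: primitive_ler ba.
  by rewrite mulr_ge0 // pi_ge0.
have := primitive_ler dP P0 ab; rewrite /P => h.
apply: (@le_trans _ _ ((B + C) * (atan b - atan a))); first by rewrite mulrBr; lra.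
by rewrite ler_wpM2l //; have := atan_ltpi2 b; have := atan_gtNpi2 a; lra.
Qed.

(** The error is v (1 - sum w) + sum w (v - a). The slack [r] covers the indices where [a i] is far
    from [v]; for tents it is 0. *)
Lemma weighted_mean_error (R : realType) (I : finType) (w a : I -> R) (v e r : R) :
  0 <= e -> (forall i, 0 <= w i) -> \sum_i w i <= 1 ->
  `|v| * (1 - \sum_i w i) <= e ->
  (forall i, w i * `|v - a i| <= w i * e + r) ->
  `|v - \sum_i a i * w i| <= 2 * e + #|I|%:R * r.
Proof.
move=> e0 w0 w1 wv wa.
have -> : v - \sum_i a i * w i = v * (1 - \sum_i w i) + \sum_i w i * (v - a i).
  rewrite mulrBr mulr1 mulr_sumr -addrA; congr (_ + _).
  by rewrite -!sumrN -big_split /=; apply: eq_bigr => i _; ring.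
apply: (le_trans (ler_normD _ _)).
have -> : 2 * e + #|I|%:R * r = e + (e + #|I|%:R * r) by ring.
apply: lerD; first by rewrite normrM [`|1 - _|]ger0_norm // subr_ge0.
apply: (le_trans (ler_norm_sum _ _ _)).
apply: (@le_trans _ _ (\sum_i (w i * e + r))).
  by apply: ler_sum => i _; rewrite normrM ger0_norm.
rewrite big_split /= -mulr_suml sumr_const mulr_natl lerD2r.
by rewrite ler_piMl.
Qed.

(** * A positive kernel and its dilates *)

Section PositiveKernel.
Context (R : realType) (V : set (R -> R)).
Hypotheses (cV : closed_subspace V) (aV : affine_stable V).
Hypothesis VR : forall f, V f -> bdd f /\ ucont f.

Lemma positive_kernel (psi : R -> R) (x1 : R) :
  V psi -> c0 psi -> 0 < psi x1 ->
  exists K, [/\ V K, forall y, 0 <= K y,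
    exists C, forall y, K y * y ^+ 2 <= C & exists y, 0 < K y].
Proof.
move=> Vpsi psi0 psix1; have [[B psiB] upsi vpsi] := psi0.
have cpsi := ucont_continuous upsi.
have [F Fpsi] := continuous_primitive cpsi.
have [G GF] := continuous_primitive (primitive_continuous Fpsi).
have [d d0 hd] : exists2 d : R, 0 < d & forall x, `|x - x1| <= d -> 0 < psi x.
  have [d d0 hd] := upsi (psi x1 / 2) (divr_gt0 psix1 (ltr0Sn _ 1)).
  exists d => // x /hd; rewrite ler_norml => /andP[? ?]; lra.
(* The mean value point for [th x1] lies within 2 h = d of [x1], where [psi] is positive. *)
pose h := d / 2; have h0 : 0 < h by rewrite /h; lra.
pose th := second_diff G h; pose p := second_diff F h; pose f := second_diff psi h.
have dth : primitive th p by exact: primitive_second_diff.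
have dp : primitive p f by exact: primitive_second_diff.
have f0 : c0 f by exact: c0_second_diff.
have Vf : V f.
  have Vs t : V (fun x => psi (x + t)).
    by have := aV 1 t Vpsi; under eq_fun do rewrite mul1r.
  have V2 : V (fun x => psi (x + h + h)).
    by under eq_fun do rewrite -addrA; exact: Vs.
  by apply: (closed_subspaceB cV); apply: (closed_subspaceB cV).
have thE x : exists2 c, th x = h ^+ 2 * psi c & `|c - x| <= 2 * h.
  exact: second_diff_mvt GF Fpsi h0.
have h2 : 0 < h ^+ 2 by rewrite exprn_gt0.
have thB : bdd th.
  exists (h ^+ 2 * B) => x; have [c -> _] := thE x.
  by rewrite normrM (gtr0_norm h2) ler_pM2l.
have thx1 : 0 < th x1.
  have [c -> cx] := thE x1; rewrite mulr_gt0 // hd // (le_trans cx) // /h; lra.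
have thv : vanishing th.
  move=> e e0; have [L L0 hL] := vpsi _ (divr_gt0 e0 h2).
  exists (L + 2 * h) => [|x xL]; first by rewrite addr_ge0 // mulr_ge0 // ltW.
  have [c -> cx] := thE x; rewrite normrM (gtr0_norm h2) mulrC -ler_pdivlMr //.
  by apply: hL; have := ler_normB c (c - x); rewrite opprB addrC subrK; lra.
(* Beyond [L] the values of [th] are at most [th x1], so the maximum over [-M, M], an interval
   containing [x1], is global. *)
have [x0 thx0] : exists x0, forall x, th x <= th x0.
  have [L L0 hL] := thv (th x1) thx1.
  pose M := Num.max L `|x1|; have M0 : 0 <= M by rewrite le_max L0.
  have [||c _ hc] := @EVT_max R th (- M) M; first by lra.
    exact: (continuous_subspaceT (primitive_continuous dth)).
  exists c => x; have [xM|Mx] := leP `|x| M.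
    by apply: hc; rewrite in_itv /= -ler_norml.
  apply: (le_trans (ler_norm _)); apply: (@le_trans _ _ (th x1)).
    by apply: hL; apply: le_lt_trans Mx; rewrite le_max lexx.
  by apply: hc; rewrite in_itv /= -ler_norml le_max lexx orbT.
have thp : 0 < th x0 by apply: lt_le_trans (thx0 x1).
pose D y := if y == 0 then f x0 else (th (x0 + y) - 2 * th x0 + th (x0 - y)) / y ^+ 2.
have VK : V (fun y => - D y).
  apply: (closed_subspaceN cV); apply: (closed_subspace_lim cV) => e e0.
  have [N N0 hN] := second_difference_lim x0 dth dp thB f0 e0.
  exists (fun y => N%:R^-2 * \sum_(j < N) \sum_(k < N) f (x0 + (j%:R - k%:R) * (y / N%:R))) => //.
  apply: (closed_subspaceZ cV).
  do 2 apply: (closed_subspace_sum cV) => ?.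
  set q := _ - _; have := aV (q / N%:R) x0 Vf.
  by congr V; apply/funext => y; congr f; ring.
exists (fun y => - D y); split=> //.
(* Away from 0 the sign comes from the maximality of [th x0]; at 0 it follows by continuity, which
   [VR] provides. *)
- have K0 y : y != 0 -> 0 <= - D y.
    move=> y0; rewrite /D (negbTE y0) -mulNr divr_ge0 ?sqr_ge0 //.
    by have := thx0 (x0 + y); have := thx0 (x0 - y); lra.
  move=> y; have [->|/K0 //] := eqVneq y 0.
  rewrite leNgt; apply/negP => D0.
  have [_ uK] := VR VK; have [|r r0 hr] := uK (D 0 / 2); first by lra.
  have := hr 0 r; rewrite sub0r normrN (gtr0_norm r0) lexx => /(_ isT).
  by rewrite ler_norml => /andP[? ?]; have := K0 r (lt0r_neq0 r0); lra.
- have [C thC] := thB; exists (4 * C) => y; rewrite /D; case: eqVneq => [->|y0].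
    by rewrite expr0n mulr0; have := thC 0; have := normr_ge0 (th 0); lra.
  rewrite mulNr divfK ?expf_neq0 //.
  have := thC (x0 + y); have := thC x0; have := thC (x0 - y).
  by rewrite !ler_norml => /andP[? ?] /andP[? ?] /andP[? ?]; lra.
- have [L L0 hL] := thv (th x0 / 2) (divr_gt0 thp (ltr0Sn _ 1)).
  (* Both x0 + y and x0 - y lie beyond [L], so the numerator of the kernel is at least [th x0]. *)
  pose y := L + `|x0| + 1; have y0 : 0 < y by rewrite /y; have := normr_ge0 x0; lra.
  exists y; rewrite /D gt_eqF // -mulNr divr_gt0 ?exprn_gt0 //.
  have h3 : `|th (x0 + y)| <= th x0 / 2.
    by apply: hL; have := ler_normB (x0 + y) x0; rewrite [x0 + y]addrC addrK (gtr0_norm y0) /y; lra.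
  have h4 : `|th (x0 - y)| <= th x0 / 2.
    by apply: hL; have := ler_normB x0 (x0 - y); rewrite opprB addrC subrK (gtr0_norm y0) /y; lra.
  by move: h3 h4; rewrite !ler_norml => /andP[? ?] /andP[? ?]; lra.
Qed.

(** The increment is [c] times the mean of [K] between [x] and x + c; the Riemann sums are
    combinations of translates of [K] and converge uniformly. *)
Lemma primitive_increment_closed (Q K : R -> R) (c : R) :
  primitive Q K -> V K -> V (fun x => Q (x + c) - Q x).
Proof.
move=> QK VK; have [_ uK] := VR VK; apply: (closed_subspace_lim cV) => e e0.
have [c00|c0] := eqVneq c 0.
  exists (fun=> 0) => [|x]; first by case: cV.
  by rewrite c00 addr0 subrr subr0 normr0 ltW.
have nc0 : 0 < `|c| by rewrite normr_gt0.
have [d d0 hd] := uK (e / `|c|) (divr_gt0 e0 nc0).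
have [N N0 [hN _]] := @exists_nat_mul_ge R `|c| 0 d d0.
have NR0 : 0 < N%:R :> R by rewrite ltr0n.
exists (fun x => c / N%:R * \sum_(k < N) K (x + k%:R * (c / N%:R))) => [|x].
  apply: (closed_subspaceZ cV); apply: (closed_subspace_sum cV) => k.
  by have := aV 1 (k%:R * (c / N%:R)) VK; under eq_fun do rewrite mul1r.
have sd : `|c / N%:R| <= d.
  by rewrite normrM normfV normr_nat ler_pdivrMr // mulrC.
have := riemann_sum_error QK hd x N sd.
rewrite (_ : N%:R * (c / N%:R) = c); last by rewrite mulrC divfK // gt_eqF.
move/le_trans; apply; rewrite normrM normfV normr_nat.
by rewrite (_ : _ * _ * _ = e) //; field; rewrite !gt_eqF.
Qed.

(* The kernel [K] is an approximate identity under dilation: the weights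
   [Q ((x - t) / d) - Q ((x - t') / d)], for a fine grid of consecutive nodes
   [t < t'], concentrate at the nodes near [x] as [d] tends to 0. *)
Lemma approximate_identity (K g : R -> R) :
  V K -> (forall y, 0 <= K y) ->
  (exists C, forall y, K y * y ^+ 2 <= C) -> (exists y, 0 < K y) ->
  c0 g -> V g.
Proof.
move=> VK K0 [C KC] [y0 Ky0] [[B gB] ug vg].
have [[BK KB] uK] := VR VK.
have [Q QK] := continuous_primitive (ucont_continuous uK).
have Qle := primitive_ler QK K0.
have KBK x : K x <= BK by apply: le_trans (KB x); rewrite ler_norm.
have [M QM] := primitive_increments_bdd QK K0 KBK KC.
have C0 : 0 <= C by have := KC 0; rewrite expr0n mulr0.
have B0 : 0 <= B by apply: le_trans (gB 0).
pose S := [set s | exists a, s = Q a - Q (- a)].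
have hS : has_sup S.
  split; first by exists (Q 0 - Q (- 0)), 0.
  by exists M => _ [a ->].
(* [kap] is the total mass of [K]. *)
pose kap := sup S.
have Qkap a b : Q b - Q a <= kap.
  pose c := Num.max `|a| `|b|.
  apply: (@le_trans _ _ (Q c - Q (- c))).
    apply: lerB; apply: Qle.
      by apply: (le_trans (ler_norm _)); rewrite le_max lexx orbT.
    by rewrite lerNl; apply: (le_trans (ler_norm _)); rewrite normrN le_max lexx.
  by apply: ub_le_sup; [exact: hS.2|exists c].
have kap0 : 0 < kap.
  have [d d0 hd] := uK (K y0 / 2) (divr_gt0 Ky0 (ltr0Sn _ 1)).
  apply: lt_le_trans (Qkap y0 (y0 + d)).
  have [c -> cle] := primitive_mvt QK y0 (y0 + d).
  move: cle; rewrite [y0 + d]addrC addrK (gtr0_norm d0) => /hd.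
  by rewrite ler_norml => /andP[h1 h2]; rewrite mulr_gt0 //; lra.
apply: (closed_subspace_lim cV) => e e0.
pose e4 := e / 4; have e40 : 0 < e4 by rewrite /e4; lra.
have [r r0 hr] := ug _ e40; have [L L0 hL] := vg _ e40.
have B1 : 0 < B + 1 by rewrite ltr_wpDl.
have eta0 : 0 < kap * (e4 / (B + 1)) by rewrite mulr_gt0 // divr_gt0.
(* The increment of [Q] from [- A] to [A] misses less than [kap * (e4 / (B + 1))] of the mass. *)
have [_ [A ->] hA] := sup_adherent eta0 hS.
pose T := L + 1; have T0 : 0 < T by rewrite /T; lra.
have r20 : 0 < r / 2 by lra.
have [J J0 [hJ _]] := @exists_nat_mul_ge R (2 * T) 0 (r / 2) r20.
have JR0 : 0 < J%:R :> R by rewrite ltr0n.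
pose h := 2 * T / J%:R.
have h0 : 0 < h by rewrite /h divr_gt0 // mulr_gt0.
have hr2 : h <= r / 2 by rewrite /h ler_pdivrMr // [r / 2 * _]mulrC.
(* [Z] is fitted to the far nodes: each contributes at most [d * Z / J%:R], hence all together at
   most [d * Z <= e4]. *)
pose Z := 16 * B * C * T / (r ^+ 2 * kap).
have Z0 : 0 <= Z by rewrite /Z divr_ge0 ?mulr_ge0 ?sqr_ge0 // ltW.
(* The bound on [d * A] keeps the dilated interval within the margin T - L = 1, so the weights add
   up to nearly 1 for every [x] in [-L, L]. For other [x] the value [g x] is small. *)
have [d d0 [dA dZ]] : exists2 d : R, 0 < d & d * A <= 1 /\ d * Z <= e4.
  pose W := `|A| + Z / e4 + 1.
  have W1 : 0 <= Z / e4 by rewrite divr_ge0 // ltW.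
  have W0 : 0 < W by rewrite /W; have := normr_ge0 A; lra.
  exists W^-1; first by rewrite invr_gt0.
  split; rewrite mulrC ler_pdivrMr // ?mul1r.
    by rewrite /W; have := ler_norm A; lra.
  by rewrite mulrC -ler_pdivrMr // /W; have := normr_ge0 A; lra.
pose t (k : nat) : R := - T + k%:R * h.
pose w (k : 'I_J) x := (Q ((x - t k) / d) - Q ((x - t k.+1) / d)) / kap.
have tS k : t k.+1 = t k + h by rewrite /t -natr1; ring.
have tl k x : (x - t k.+1) / d <= (x - t k) / d.
  by rewrite ler_pM2r ?invr_gt0 // tS; lra.
have w0 k x : 0 <= w k x.
  by rewrite /w divr_ge0 ?(ltW kap0) // subr_ge0; exact: Qle.
have tJ : t J = T by rewrite /t /h mulrC divfK ?gt_eqF //; ring.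
have t0 : t 0%N = - T by rewrite /t mul0r addr0.
have sumw x : \sum_(k < J) w k x = (Q ((x + T) / d) - Q ((x - T) / d)) / kap.
  rewrite /w -mulr_suml; congr (_ / _).
  transitivity (\sum_(0 <= k < J) (- Q ((x - t k.+1) / d) - - Q ((x - t k) / d))).
    by rewrite big_mkord; apply: eq_bigr => k _; rewrite opprK addrC.
  by rewrite (telescope_sumr (fun k => - Q ((x - t k) / d))) // tJ t0 !opprK addrC.
exists (fun x => \sum_(k < J) g (t k) * w k x) => [|x].
  apply: (closed_subspace_sum cV) => k; apply: (closed_subspaceZ cV).
  rewrite /w; under eq_fun do rewrite mulrC; apply: (closed_subspaceZ cV).
  have := aV d^-1 (- t k.+1 / d) (primitive_increment_closed (h / d) QK VK).
  congr V; apply/funext => x; rewrite tS; congr (Q _ - Q _); ring.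
have eE : e = 2 * e4 + 2 * e4 by rewrite /e4; field.
have wle1 : \sum_(k < J) w k x <= 1 by rewrite sumw ler_pdivrMr // mul1r.
rewrite eE; apply: le_trans (@weighted_mean_error R _ (w^~ x) (fun k : 'I_J => g (t k)) (g x) e4 (d * Z / J%:R) (ltW e40) _ wle1 _ _) _ => //.
- have [xL|Lx] := leP `|x| L; last first.
    apply: le_trans (hL _ Lx); rewrite ler_piMr //.
    by rewrite lerBlDr lerDl sumr_ge0.
  apply: (@le_trans _ _ (B * (e4 / (B + 1)))); last first.
    by rewrite mulrA ler_pdivrMr // mulrC ler_pM2l //; lra.
  apply: ler_pM => //; first by rewrite subr_ge0.
  rewrite lerBlDr -lerBlDl sumw ler_pdivlMr // mulrBl mul1r.
  apply: (@le_trans _ _ (Q A - Q (- A))); first by rewrite [_ * kap]mulrC ltW.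
  move: xL; rewrite ler_norml => /andP[x1 x2].
  apply: lerB; apply: Qle; first by rewrite ler_pdivlMr // mulrC; apply: (le_trans dA); rewrite /T; lra.
  by rewrite ler_pdivrMr // mulNr [A * d]mulrC lerNr; apply: (le_trans dA); rewrite /T; lra.
- move=> k; have [xt|tx] := leP `|x - t k| r.
    apply: (@le_trans _ _ (w k x * e4)); first by rewrite ler_wpM2l // hr.
    by rewrite lerDl divr_ge0 ?ler0n // mulr_ge0 // ltW.
  apply: (@le_trans _ _ (d * Z / J%:R)); last by rewrite lerDr mulr_ge0 // ltW.
  have gg : `|g x - g (t k)| <= 2 * B.
    by have := ler_normB (g x) (g (t k)); have := gB x; have := gB (t k); lra.
  (* At a far node the mean value point [c] has |c d| >= r / 2, because [h <= r / 2]; there K(c) c^2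
     <= C makes the weight small with [d]. *)
  have wB : w k x <= 4 * C * d * h / (r ^+ 2 * kap).
    have [c E cle] := primitive_mvt QK ((x - t k) / d) ((x - t k.+1) / d).
    have {}E : Q ((x - t k) / d) - Q ((x - t k.+1) / d) = K c * (h / d).
      by rewrite -opprB E tS; ring.
    have {}cle : `|c * d - (x - t k)| <= h.
      rewrite (_ : c * d - _ = (c - (x - t k) / d) * d); last by field; rewrite gt_eqF.
      rewrite normrM (gtr0_norm d0) -ler_pdivlMr //; apply: (le_trans cle).
      rewrite tS (_ : _ - _ = - (h / d)); last by ring.
      by rewrite normrN gtr0_norm // divr_gt0.
    have cd : r / 2 <= `|c * d|.
      by have := ler_normB (c * d) (c * d - (x - t k)); rewrite opprB addrC subrK; lra.
    have Kr : K c * r ^+ 2 <= 4 * C * d ^+ 2.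
      apply: (@le_trans _ _ (K c * (4 * (c * d) ^+ 2))).
        rewrite ler_wpM2l //.
        have : (r / 2) ^+ 2 <= `|c * d| ^+ 2 by rewrite ler_pXn2r ?nnegrE // ltW.
        by rewrite real_normK ?num_real // expr_div_n; lra.
      have d24 : 0 < 4 * d ^+ 2 by rewrite mulr_gt0 // exprn_gt0.
      have h1 := KC c; rewrite -(ler_pM2r d24) in h1.
      have e1 : K c * c ^+ 2 * (4 * d ^+ 2) = K c * (4 * (c * d) ^+ 2) by ring.
      have e2 : C * (4 * d ^+ 2) = 4 * C * d ^+ 2 by ring.
      by rewrite -e1 -e2.
    rewrite /w E ler_pdivlMr ?mulr_gt0 ?exprn_gt0 //.
    rewrite (_ : _ * (r ^+ 2 * kap) = K c * r ^+ 2 * (h / d)); last by field; rewrite !gt_eqF.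
    apply: (@le_trans _ _ (4 * C * d ^+ 2 * (h / d))).
      by rewrite ler_wpM2r // divr_ge0 // ltW.
    by rewrite le_eqVlt; apply/orP; left; apply/eqP; field; rewrite gt_eqF.
  apply: (@le_trans _ _ (4 * C * d * h / (r ^+ 2 * kap) * (2 * B))); first exact: ler_pM.
  by rewrite le_eqVlt; apply/orP; left; apply/eqP; rewrite /h /Z; field; rewrite !gt_eqF.
- rewrite card_ord [J%:R * _]mulrC divfK ?gt_eqF //.
  by clear - dZ e40; lra.
Qed.

End PositiveKernel.

(** The kernel is built among the bounded uniformly continuous elements of [V], from [psi] or from
    its negative according to the sign at [x1]. *)
Theorem c0_sub_closed_affine_stable (R : realType) (V : set (R -> R)) (psi : R -> R) :
  closed_subspace V -> affine_stable V -> V psi -> c0 psi ->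
  (exists x, psi x != 0) -> forall g, c0 g -> V g.
Proof.
move=> cV aV Vpsi psi0 [x1 psix1] g g0.
pose V' := V `&` [set f | bdd f /\ ucont f].
have cV' : closed_subspace V' by exact: closed_subspace_bdd_ucont.
have aV' : affine_stable V' by exact: affine_stable_bdd_ucont.
have VR' f : V' f -> bdd f /\ ucont f by case.
have [psiB upsi _] := psi0.
have Vpsi' : V' psi by [].
suff : V' g by case.
have [psi_gt0|psi_le0] := ltP 0 (psi x1).
  have [K [VK K0 KC Kpos]] := positive_kernel cV' aV' VR' Vpsi' psi0 psi_gt0.
  exact: approximate_identity cV' aV' VR' _ _ VK K0 KC Kpos g0.
have Npsi0 : c0 (fun x => - psi x).
  have := c0B (c0B psi0 psi0) psi0; congr c0; apply/funext => x; ring.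
have VN := closed_subspaceN cV' Vpsi'.
have Npsi : 0 < - psi x1 by rewrite oppr_gt0 lt_neqAle psix1.
have [K [VK K0 KC Kpos]] := positive_kernel cV' aV' VR' VN Npsi0 Npsi.
exact: approximate_identity cV' aV' VR' _ _ VK K0 KC Kpos g0.
Qed.

(** * Uniform closures, linear spans and outer functions *)

(** Trading the strict bound on the supremum for a pointwise bound costs a halving of [e] and avoids
    extended reals from here on. *)
Lemma unif_closureP (R : realType) (T : Type) (S : set (T -> R)) (h : T -> R) :
  unif_closure S h <->
  (forall e : R, 0 < e -> exists2 s, S s & forall x, `|h x - s x| <= e).
Proof.
split=> H e e0.
  have [s Ss hs] := H e e0; exists s => // x.
  rewrite -lee_fin; apply: le_trans (ltW hs).
  by apply: ereal_sup_ubound; exists x.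
have e20 : 0 < e / 2 by lra.
have [s Ss hs] := H _ e20; exists s => //.
apply: (@le_lt_trans _ _ (e / 2)%:E); last by rewrite lte_fin; lra.
by apply: ge_ereal_sup => _ [x _ <-]; rewrite lee_fin.
Qed.

Lemma sub_unif_closure (R : realType) (T : Type) (S : set (T -> R)) :
  S `<=` unif_closure S.
Proof.
move=> f Sf; apply/unif_closureP => e e0; exists f => // x.
by rewrite subrr normr0 ltW.
Qed.

Lemma sub_lin_span (R : realType) (T : Type) (S : set (T -> R)) :
  S `<=` lin_span S.
Proof.
move=> f Sf; exists 1%N, (fun=> 1), (fun=> f); split=> //.
by apply/funext => x; rewrite big_ord1 mul1r.
Qed.

Lemma lin_spanZ (R : realType) (T : Type) (S : set (T -> R)) (a : R) f :
  lin_span S f -> lin_span S (fun x => a * f x).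
Proof.
move=> [k [c [g [Sg ->]]]]; exists k, (fun i => a * c i), g; split=> //.
by apply/funext => x; rewrite mulr_sumr; under eq_bigr do rewrite mulrA.
Qed.

Lemma lin_spanD (R : realType) (T : Type) (S : set (T -> R)) f g :
  lin_span S f -> lin_span S g -> lin_span S (fun x => f x + g x).
Proof.
move=> [k [c [u [Su ->]]]] [l [d [v [Sv ->]]]].
exists (k + l)%N, (fun i : 'I_(k + l) => match fintype.split i with inl i => c i | inr i => d i end).
exists (fun i : 'I_(k + l) => match fintype.split i with inl i => u i | inr i => v i end).
split=> [i|]; first by case: (fintype.split i).
apply/funext => x; rewrite big_split_ord /=; congr (_ + _); apply: eq_bigr => i _.
  by rewrite (unsplitK (inl i : 'I_k + 'I_l)).
by rewrite (unsplitK (inr i : 'I_k + 'I_l)).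
Qed.

Lemma closed_subspace_unif_closure (R : realType) (T : Type) (S : set (T -> R)) :
  closed_subspace (unif_closure (lin_span S)).
Proof.
split.
- apply: sub_unif_closure; exists 0%N, (fun=> 0), (fun=> fun=> 0).
  by split=> [[]|] //; apply/funext => x; rewrite big_ord0.
- move=> f g /unif_closureP hf /unif_closureP hg; apply/unif_closureP => e e0.
  have e20 : 0 < e / 2 by lra.
  have [s Ss hs] := hf _ e20; have [t St ht] := hg _ e20.
  exists (fun x => s x + t x) => [|x]; first exact: lin_spanD.
  rewrite (_ : _ - _ = f x - s x + (g x - t x)); last by ring.
  apply: (le_trans (ler_normD _ _)); have := hs x; have := ht x; lra.
- move=> c f /unif_closureP hf; apply/unif_closureP => e e0.
  have c1 : 0 < `|c| + 1 by rewrite ltr_wpDl.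
  have [s Ss hs] := hf _ (divr_gt0 e0 c1).
  exists (fun x => c * s x) => [|x]; first exact: lin_spanZ.
  rewrite -mulrBr normrM.
  apply: (@le_trans _ _ ((`|c| + 1) * `|f x - s x|)).
    by rewrite ler_wpM2r // lerDl.
  by rewrite mulrC -ler_pdivlMr.
- move=> f hf; apply/unif_closureP => e e0; have e20 : 0 < e / 2 by lra.
  have [s /unif_closureP hs sf] := hf _ e20; have [t St ht] := hs _ e20.
  exists t => // x; rewrite (_ : _ - _ = f x - s x + (s x - t x)); last by ring.
  apply: (le_trans (ler_normD _ _)); have := sf x; have := ht x; lra.
Qed.

(** All that the layers need to know of [phi]. Quantifying over every [V] allows spaces of outer
    functions attached to a layer, as in [c0_generating_comp]. *)
Definition c0_generating (R : realType) (phi : R -> R) : Prop :=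
  forall V : set (R -> R), closed_subspace V -> affine_stable V -> V phi ->
  forall g, c0 g -> V g.

(** The outer functions [g] for which the conclusion holds for all [f] and [b] form a closed
    subspace. It is affine stable because [E] is stable under scaling, and it contains [phi]. *)
Lemma c0_generating_comp (R : realType) (T : Type) (phi : R -> R)
    (E W : set (T -> R)) :
  c0_generating phi -> closed_subspace W ->
  (forall f (a : R), E f -> E (fun x => a * f x)) ->
  (forall f (b : R), E f -> W (fun x => phi (f x + b))) ->
  forall g f (b : R), c0 g -> E f -> W (fun x => g (f x + b)).
Proof.
move=> gphi cW EZ EW g f b g0 Ef.
pose V : set (R -> R) := [set g | forall f (b : R), E f -> W (fun x => g (f x + b))].
suff : V g by apply.
apply: (gphi V) => //.
- split=> [f' b' Ef'|u v Vu Vv f' b' Ef'|c u Vu f' b' Ef'|u hu f' b' Ef'].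
  + by case: cW.
  + exact: closed_subspaceD (Vu _ _ Ef') (Vv _ _ Ef').
  + exact: closed_subspaceZ (Vu _ _ Ef').
  + apply: (closed_subspace_lim cW) => e /hu[s Vs hs].
    by exists (fun x => s (f' x + b')) => [|x]; [exact: Vs|exact: hs].
- move=> u a c Vu f' b' Ef'.
  have := Vu _ (a * b' + c) (EZ _ a Ef').
  by under eq_fun do rewrite addrA -mulrDr.
Qed.

(** * Products of ridge functions *)

Definition witch (R : realType) (t : R) : R := (1 + t ^+ 2)^-1.

Lemma witch_den_gt0 (R : realType) (t : R) : 0 < 1 + t ^+ 2.
Proof. by rewrite ltr_pwDl // sqr_ge0. Qed.

Lemma witch_gt0 (R : realType) (t : R) : 0 < witch t.
Proof. by rewrite invr_gt0 witch_den_gt0. Qed.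

Lemma witch_le1 (R : realType) (t : R) : witch t <= 1.
Proof. by rewrite invf_le1 ?witch_den_gt0 // lerDl sqr_ge0. Qed.

Lemma norm_mul_witch_le (R : realType) (t : R) : `|t * witch t| <= 1 / 2.
Proof.
rewrite normrM (gtr0_norm (witch_gt0 t)) ler_pdivrMr ?witch_den_gt0 //.
by have := sqr_ge0 (`|t| - 1); rewrite sqrrB1 real_normK ?num_real //; lra.
Qed.

Lemma c0M (R : realType) (f g : R -> R) :
  c0 f -> c0 g -> c0 (fun x => f x * g x).
Proof.
move=> [[B fB] uf vf] [[C gC] ug vg].
have B0 : 0 <= B by apply: le_trans (fB 0).
have C0 : 0 <= C by apply: le_trans (gC 0).
have BC : 0 < B + C + 1 by lra.
split.
- by exists (B * C) => x; rewrite normrM ler_pM.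
- move=> e e0; have e1 : 0 < e / (B + C + 1) by rewrite divr_gt0.
  have [d d0 hd] := uf _ e1; have [d' d'0 hd'] := ug _ e1.
  exists (Num.min d d') => [|x y]; first by rewrite lt_min d0.
  rewrite le_min => /andP[/hd h1 /hd' h2].
  rewrite (_ : f x * g x - _ = f x * (g x - g y) + (f x - f y) * g y); last by ring.
  apply: (le_trans (ler_normD _ _)); rewrite !normrM.
  apply: (@le_trans _ _ (B * (e / (B + C + 1)) + e / (B + C + 1) * C)).
    by rewrite lerD // ler_pM.
  rewrite [B * _]mulrC -mulrDr mulrAC ler_pdivrMr // ler_pM2l //; lra.
- move=> e e0; have e1 : 0 < e / (B + C + 1) by rewrite divr_gt0.
  have [L L0 hL] := vf _ e1; exists L => // x /hL h.
  rewrite normrM; apply: (@le_trans _ _ (e / (B + C + 1) * C)); first exact: ler_pM.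
  by rewrite mulrAC ler_pdivrMr // ler_pM2l //; lra.
Qed.

Lemma c0_witch (R : realType) : c0 (@witch R).
Proof.
split.
- by exists 1 => x; rewrite gtr0_norm ?witch_gt0 // witch_le1.
- move=> e e0; exists e => // x y xy; apply: (le_trans _ xy).
  have -> : witch x - witch y = (y - x) * (x * witch x * witch y + y * witch y * witch x).
    by rewrite /witch; field; rewrite !gt_eqF ?witch_den_gt0.
  rewrite normrM distrC ler_piMr // (le_trans (ler_normD _ _)) //.
  have h (u v : R) : `|u * witch u * witch v| <= 1 / 2.
    rewrite normrM (gtr0_norm (witch_gt0 v)); have := norm_mul_witch_le u.
    have := witch_le1 v; have := witch_gt0 v; have := normr_ge0 (u * witch u).
    by move=> *; nra.
  by have := h x y; have := h y x; lra.
- move=> e e0; exists e^-1 => [|x]; first by rewrite invr_ge0 ltW.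
  move=> ex; rewrite (gtr0_norm (witch_gt0 x)).
  have x0 : 0 < `|x| by apply: lt_trans ex; rewrite invr_gt0.
  have := norm_mul_witch_le x; rewrite normrM (gtr0_norm (witch_gt0 x)) mulrC -ler_pdivlMr //.
  move=> /le_trans; apply; rewrite ler_pdivrMr //.
  by move: ex; rewrite -(ltr_pM2l e0) mulfV ?gt_eqF //; lra.
Qed.

(** The derivative (1 - t^2) / (1 + t^2)^2 of t / (1 + t^2), written in [witch] alone so that [c0B]
    and [c0M] apply. *)
Definition dwitch (R : realType) (t : R) : R :=
  witch t * witch t - (witch t - witch t * witch t).

Lemma c0_dwitch (R : realType) : c0 (@dwitch R).
Proof.
have w := c0_witch R; exact: c0B (c0M w w) (c0B w (c0M w w)).
Qed.

Lemma primitive_dwitch (R : realType) : primitive (fun t : R => t * witch t) (@dwitch R).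
Proof.
suff : forall t : R, is_derive t (1 : R) (fun t => t * witch t) (dwitch t) by [].
move=> t.
have h1 : is_derive t (1 : R) (fun y : R => 1 + y ^+ 2) (0 + (t *: (1 : R) + t *: (1 : R))).
  have sq := is_deriveM (is_derive_id t (1 : R)) (is_derive_id t (1 : R)).
  exact: (is_deriveD (is_derive_cst (1 : R) t (1 : R)) sq).
have n0 : 1 + t ^+ 2 != 0 by rewrite gt_eqF // witch_den_gt0.
have h2 := @is_deriveV R (fun y : R => 1 + y ^+ 2) t _ 1 n0 h1.
have h3 := is_deriveM (is_derive_id t (1 : R)) h2.
rewrite (_ : dwitch t = t *: (- (1 + t ^+ 2) ^- 2 *: (0 + (t *: (1 : R) + t *: (1 : R))))
  + (1 + t ^+ 2)^-1 *: (1 : R)); first exact: h3.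
by rewrite /dwitch /witch /GRing.scale /=; field.
Qed.

Section Products.
Context (R : realType) (T : Type) (A W : set (T -> R)).
Hypothesis AD : forall f g (a b c : R), A f -> A g -> A (fun x => a * f x + b * g x + c).
Hypothesis cW : closed_subspace W.

(** Meant for a partial product of ridge functions, ready to take one more factor; [multiplier_mul]
    shows that the result is ready again. *)
Definition multiplier (M : T -> R) : Prop :=
  bdd M /\ forall g f, c0 g -> A f -> W (fun x => M x * g (f x)).

Lemma closed_subspace_mul (N : T -> R) (V : set (T -> R)) :
  bdd N -> V `<=` [set f | W (fun x => N x * f x)] ->
  forall f, (forall e : R, 0 < e -> exists2 s, V s & forall x, `|f x - s x| <= e) ->
  W (fun x => N x * f x).
Proof.
move=> [B NB] VN f hf; apply: (closed_subspace_lim cW) => e e0.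
have B1 : 0 < `|B| + 1 by rewrite ltr_wpDl.
have [s /VN Ws hs] := hf _ (divr_gt0 e0 B1).
exists (fun x => N x * s x) => // x; rewrite -mulrBr normrM.
apply: (@le_trans _ _ ((`|B| + 1) * (e / (`|B| + 1)))).
  apply: ler_pM => //; apply: (le_trans (NB x)).
  by apply: (le_trans (ler_norm B)); rewrite lerDl.
by rewrite mulrC divfK // gt_eqF.
Qed.

(* [(p u - p v) / (u - v)] for [p t = t / (1 + t^2)] is the mean of [p'] over
   the segment from [v] to [u]; it equals [(1 - u v) / ((1 + u^2) (1 + v^2))],
   and the numerator loses its term [u v] when the cases [v] and [- v] are added. *)
Lemma multiplier_witch (M f1 f2 : T -> R) : multiplier M -> A f1 -> A f2 ->
  W (fun x => M x * witch (f1 x) * witch (f2 x)).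
Proof.
move=> [bM WM] Af1 Af2.
pose q f x := (1 - f1 x * f x) * witch (f1 x) * witch (f x).
have Wq f : A f -> W (fun x => M x * q f x).
  move=> Af; apply: (closed_subspace_mul (V := [set g | W (fun x => M x * g x)]) bM) => //.
  have bp : bdd (fun t : R => t * witch t).
    by exists (1 / 2) => t; exact: norm_mul_witch_le.
  move=> e e0.
  have [N N0 hN] := divided_difference_lim (@primitive_dwitch R) bp (c0_dwitch R) e0.
  have NR0 : N%:R != 0 :> R by rewrite pnatr_eq0 -lt0n.
  exists (fun x => N%:R^-1 * \sum_(k < N) dwitch (f1 x + k%:R * ((f x - f1 x) / N%:R))) => [|x].
    have := closed_subspaceZ cW N%:R^-1 (closed_subspace_sum cW (index_enum 'I_N)
      (fun k => WM _ _ (c0_dwitch R) (AD (1 - k%:R / N%:R) (k%:R / N%:R) 0 Af1 Af))).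
    rewrite /=; congr W; apply/funext => x; rewrite [RHS]mulrCA; congr (_ * _); rewrite mulr_sumr.
    by apply: eq_bigr => k _; congr (_ * dwitch _); field.
  have := hN (f1 x) (f x - f1 x); congr (`|_ - _| <= _).
  rewrite subr_eq0 /q; case: eqVneq => [->|ne].
    by rewrite /dwitch /witch; field; rewrite gt_eqF // witch_den_gt0.
  rewrite [f1 x + _]addrC subrK /witch; field.
  by rewrite subr_eq0 ne !gt_eqF ?witch_den_gt0.
have Af2N : A (fun x => - f2 x).
  by have := AD (-1) 0 0 Af2 Af2; under eq_fun do rewrite mul0r !addr0 mulN1r.
have := closed_subspaceZ cW (1 / 2) (closed_subspaceD cW (Wq _ Af2) (Wq _ Af2N)).
congr W; apply/funext => x; rewrite /q /witch; field.
by rewrite !gt_eqF ?witch_den_gt0.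
Qed.

Lemma bdd_mul_c0 (M f : T -> R) (g : R -> R) :
  bdd M -> c0 g -> bdd (fun x => M x * g (f x)).
Proof.
move=> [B MB] [[C gC] _ _]; exists (B * C) => x.
by rewrite normrM ler_pM.
Qed.

(** One-dimensional density is applied twice to [multiplier_witch]: it replaces one [witch] by an
    arbitrary function in C_0(R), then the other. *)
Lemma multiplier_mul (M f : T -> R) (g : R -> R) :
  multiplier M -> A f -> c0 g -> multiplier (fun x => M x * g (f x)).
Proof.
move=> mM Af g0; have [bM WM] := mM; split; first exact: bdd_mul_c0.
have Aaff f' (a b : R) : A f' -> A (fun x => a * f' x + b).
  by move=> Af'; have := AD a 0 b Af' Af'; under eq_fun do rewrite mul0r addr0.
have w0 : exists x : R, witch x != 0 by exists 0; rewrite gt_eqF // witch_gt0.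
(* [N f1] is the factor held fixed: [M x * witch (f1 x)] in the first pass, [M x * g (f1 x)] in the
   second. *)
have cN (N : (T -> R) -> T -> R) : (forall f', A f' -> bdd (N f')) ->
    closed_subspace [set g : R -> R | forall f1 f2, A f1 -> A f2 -> W (fun x => N f1 x * g (f2 x))].
  move=> bN; split=> [f1 f2 _ _|u v Vu Vv f1 f2 A1 A2|c u Vu f1 f2 A1 A2|u hu f1 f2 A1 A2].
  - by under eq_fun do rewrite mulr0; case: cW.
  - by under eq_fun do rewrite mulrDr; apply: (closed_subspaceD cW); [exact: Vu|exact: Vv].
  - by under eq_fun do rewrite mulrCA; apply: (closed_subspaceZ cW); exact: Vu.
  - apply: (closed_subspace_mul (V := [set g | W (fun x => N f1 x * g x)]) (bN _ A1)) => //.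
    move=> e /hu[s Vs hs]; exists (fun x => s (f2 x)) => [|x]; first exact: Vs.
    exact: hs.
have aN (N : (T -> R) -> T -> R) : affine_stable
    [set g : R -> R | forall f1 f2, A f1 -> A f2 -> W (fun x => N f1 x * g (f2 x))].
  by move=> u a b Vu f1 f2 A1 A2; apply: (Vu f1 (fun x => a * f2 x + b)) => //; exact: Aaff.
have dense N : (forall f', A f' -> bdd (N f')) ->
    (forall f1 f2, A f1 -> A f2 -> W (fun x => N f1 x * witch (f2 x))) ->
    forall g' f1 f2, c0 g' -> A f1 -> A f2 -> W (fun x => N f1 x * g' (f2 x)).
  move=> bN hN g' f1 f2 g'0.
  exact: (c0_sub_closed_affine_stable (cN N bN) (aN N) hN (c0_witch R) w0 g'0).
have h1 g' f1 f2 : c0 g' -> A f1 -> A f2 -> W (fun x => M x * witch (f1 x) * g' (f2 x)).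
  apply: (dense (fun f1 x => M x * witch (f1 x))) => [f' _|u v Au Av].
    exact: bdd_mul_c0 bM (c0_witch R).
  exact: (multiplier_witch mM).
move=> g' f' g'0 Af'; apply: (dense (fun f1 x => M x * g (f1 x))) => // [f'' _|f1 f2 A1 A2].
  exact: bdd_mul_c0.
by under eq_fun do rewrite mulrAC; exact: h1.
Qed.

Lemma multiplier_prod (I : Type) (r : seq I) (g : I -> R -> R) (f : I -> T -> R) :
  (forall g f, c0 g -> A f -> W (fun x => g (f x))) ->
  (forall i, c0 (g i)) -> (forall i, A (f i)) ->
  multiplier (fun x => \prod_(i <- r) g i (f i x)).
Proof.
move=> WA g0 Af; elim: r => [|i r IH].
  under eq_fun do rewrite big_nil; split; first by exists 1 => x; rewrite normr1.
  by move=> g' f' *; under eq_fun do rewrite mul1r; exact: WA.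
by under eq_fun do rewrite big_cons mulrC; exact: multiplier_mul.
Qed.

End Products.

(** * Decay, boundedness and uniform continuity in C_0(R^n) *)

Lemma norm_coord_le_enorm (R : realType) (n : nat) (x : 'rV[R]_n) (i : 'I_n) :
  `|x ord0 i| <= enorm x.
Proof.
rewrite /enorm -sqrtr_sqr ler_wsqrtr // /dot (bigD1 i) //= -expr2 lerDl.
by apply: sumr_ge0 => j _; rewrite -expr2 sqr_ge0.
Qed.

Lemma C0_vanishing (R : realType) (n : nat) (h : 'rV[R]_n -> R) : C0 R n h ->
  forall e : R, 0 < e ->
  exists2 L : R, 0 <= L & forall (x : 'rV[R]_n) (i : 'I_n), L < `|x ord0 i| -> `|h x| <= e.
Proof.
case=> _ hv e e0.
have [M _ hM] : at_infinity R n (h @^-1` [set y | `|y| <= e]).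
  apply: hv; apply/nbhs_ballP; exists e => //= y.
  by rewrite /ball /= sub0r normrN => /ltW.
exists `|M| => // x i xM; apply: hM => /=.
apply: le_lt_trans (ler_norm M) _.
exact: lt_le_trans xM (norm_coord_le_enorm x i).
Qed.

Lemma compact_cube (R : realType) (n : nat) (L : R) :
  compact [set v : 'rV[R]_n | forall i, v ord0 i \in `[- L, L]].
Proof.
by apply: (@rV_compact _ _ (fun=> `[- L, L]%classic)) => _; exact: segment_compact.
Qed.

Lemma C0_bdd (R : realType) (n : nat) (h : 'rV[R]_n -> R) : C0 R n h -> bdd h.
Proof.
move=> hC; have [L L0 hL] := C0_vanishing hC ltr01.
have [||c _ hc] := EVT_max_rV (f := fun x => `|h x|) _ (@compact_cube R n L).
- by exists 0 => i; rewrite mxE in_itv /=; lra.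
- apply: continuous_subspaceT => x.
  by apply: continuous_comp; [exact: hC.1|exact: norm_continuous].
exists (1 + `|h c|) => x; have [xL|] := pselect (forall i, `|x ord0 i| <= L).
  apply: (@le_trans _ _ `|h c|); last by rewrite lerDr.
  by apply: hc; rewrite inE => i; rewrite in_itv /= -ler_norml.
move=> /existsNP[i /negP]; rewrite -ltNge => /hL h1.
by apply: (le_trans h1); rewrite lerDl.
Qed.

(** Compactness gives one [d] for a whole cube; off the cube [h] is small at both points. *)
Lemma C0_ucont (R : realType) (n : nat) (h : 'rV[R]_n -> R) : C0 R n h ->
  forall e : R, 0 < e -> exists2 d : R, 0 < d &
  forall x y : 'rV[R]_n, (forall i, `|x ord0 i - y ord0 i| <= d) -> `|h x - h y| <= e.
Proof.
move=> hC e e0; have e20 : 0 < e / 2 by lra.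
have [L L0 hL] := C0_vanishing hC e20.
(* The cube exceeds [-L, L] by 1 so that, with [d < 1], a point within [d] of one off the cube still
   has a coordinate beyond [L]. *)
have /compact_near_coveringP cK := @compact_cube R n (L + 1).
pose P (d : R) (x : 'rV[R]_n) := forall y : 'rV[R]_n,
  (forall i, `|x ord0 i - y ord0 i| <= d) -> `|h x - h y| <= e.
have nP : \forall d \near (0 : R)^'+, [set v : 'rV[R]_n | forall i, v ord0 i \in `[- (L + 1), L + 1]] `<=` P d.
  apply: cK => x _; have /cvgrPdist_le /(_ _ e20) /nbhs_ballP[r /= r0 hr] := hC.1 x.
  have r20 : 0 < r / 2 by lra.
  exists (ball x (r / 2), [set d : R | d < r / 2]).
    split; first exact: nbhsx_ballx.
    exact: nbhs_right_lt.
  move=> [x' d] /= [xx' dr] y xy.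
  have h1 : `|h x - h x'| <= e / 2.
    by apply: hr; apply: le_ball xx'; lra.
  have h2 : `|h x - h y| <= e / 2.
    apply: hr; move: xx' => [_ xx']; split=> // i j.
    have := xx' i j; rewrite /ball /= (ord1 i) => h3.
    have := xy j; have := ler_normD (x ord0 j - x' ord0 j) (x' ord0 j - y ord0 j).
    by rewrite addrA subrK; lra.
  rewrite (_ : _ - _ = (h x - h y) - (h x - h x')); last by ring.
  by apply: (le_trans (ler_normB _ _)); lra.
have nd : \forall d \near (0 : R)^'+, ([set v : 'rV[R]_n | forall i, v ord0 i \in `[- (L + 1), L + 1]] `<=` P d) /\ (0 < d < 1).
  near=> d; split; first by near: d.
  by apply/andP; split; near: d; [exact: nbhs_right_gt|exact: nbhs_right_lt].
have [d [dP /andP[d0 d1]]] := @filter_ex _ _ (at_right_proper_filter (0 : R)) _ nd.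
exists d => // x y xy; have [xL|] := pselect (forall i, `|x ord0 i| <= L + 1).
  by apply: dP xy => i; rewrite in_itv /= -ler_norml.
move=> /existsNP[i /negP]; rewrite -ltNge => xi.
have yi : L < `|y ord0 i|.
  have := xy i; have := ler_normD (x ord0 i - y ord0 i) (y ord0 i).
  by rewrite subrK; lra.
have xi' : L < `|x ord0 i| by lra.
by apply: (le_trans (ler_normB _ _)); have := hL _ _ xi'; have := hL _ _ yi; lra.
Unshelve. all: by end_near. Qed.

Lemma C0_1_c0 (R : realType) (h : 'rV[R]_1 -> R) :
  C0 R 1 h -> c0 (fun t => h (const_mx t)).
Proof.
move=> hC; split.
- by have [B hB] := C0_bdd hC; exists B => t.
- move=> e /(C0_ucont hC)[d d0 hd]; exists d => // x y xy.
  by apply: hd => i; rewrite !mxE.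
- move=> e /(C0_vanishing hC)[L L0 hL]; exists L => // t Lt.
  by apply: (hL _ ord0); rewrite mxE.
Qed.

Lemma dot_const1 (R : realType) (a : 'rV[R]_1) (t : R) :
  dot a (const_mx t) = a ord0 ord0 * t.
Proof. by rewrite /dot big_ord1 mxE. Qed.

(** A closed affine stable [V] containing [phi] contains the first layer on the line and its uniform
    limits, hence [psi]. *)
Lemma c0_generating_of_closure (R : realType) (phi : R -> R) (psi : 'rV[R]_1 -> R) :
  unif_closure (NN phi 1 1) psi -> C0 R 1 psi -> psi <> (fun=> 0) ->
  c0_generating phi.
Proof.
move=> /unif_closureP psiN psi0 psi_neq0 V cV aV Vphi.
apply: (c0_sub_closed_affine_stable cV aV (psi := fun t => psi (const_mx t))).
- apply: (closed_subspace_lim cV) => e /psiN[s [k [c [g [gN ->]]]] hs].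
  exists (fun t => \sum_(i < k) c i * g i (const_mx t)) => // .
  apply: (closed_subspace_sum cV) => i; apply: (closed_subspaceZ cV).
  have [a _ [b _ <-]] := gN i.
  by under eq_fun do rewrite dot_const1; exact: aV.
- exact: C0_1_c0.
- apply: contra_notP psi_neq0 => psi_eq0; apply/funext => x.
  apply/eqP; apply: contra_notT psi_eq0 => psix; exists (x ord0 ord0).
  rewrite (_ : const_mx _ = x) //; apply/rowP => i.
  by rewrite mxE (ord1 i).
Qed.

(** * Tents and their tensor products *)

Definition clamp (R : realType) (t : R) : R := Num.max 0 (Num.min 1 t).

Lemma clamp_ge0 (R : realType) (t : R) : 0 <= clamp t.
Proof. by rewrite le_max lexx. Qed.

Lemma clamp_le1 (R : realType) (t : R) : clamp t <= 1.
Proof. by rewrite ge_max ler01 ge_min lexx. Qed.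

Lemma clamp_le0 (R : realType) (t : R) : t <= 0 -> clamp t = 0.
Proof. by move=> t0; rewrite /clamp max_l // ge_min t0 orbT. Qed.

Lemma clamp_ge1 (R : realType) (t : R) : 1 <= t -> clamp t = 1.
Proof. by move=> t1; rewrite /clamp min_l // max_r. Qed.

Lemma clamp_id (R : realType) (t : R) : 0 <= t <= 1 -> clamp t = t.
Proof. by move=> /andP[t0 t1]; rewrite /clamp min_r // max_r. Qed.

Lemma ler_clamp (R : realType) (s t : R) : s <= t -> clamp s <= clamp t.
Proof.
by move=> st; rewrite /clamp; apply: le_max2; rewrite ?lexx //; apply: le_min2; rewrite ?lexx.
Qed.

Lemma clamp_lipschitz (R : realType) (s t : R) : `|clamp s - clamp t| <= `|s - t|.
Proof.
wlog st : s t / t <= s.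
  move=> H; have [/H //|/ltW ts] := leP t s.
  by rewrite distrC [leRHS]distrC; exact: H.
rewrite !ger0_norm ?subr_ge0 ?ler_clamp //.
have clampE (u : R) : [\/ u <= 0 /\ clamp u = 0, 0 <= u <= 1 /\ clamp u = u | 1 <= u /\ clamp u = 1].
  have [u0|/ltW u0] := leP u 0; first by constructor 1; rewrite clamp_le0.
  have [u1|/ltW u1] := leP u 1; first by constructor 2; rewrite clamp_id ?u0.
  by constructor 3; rewrite clamp_ge1.
by case: (clampE s) => -[hs ->]; case: (clampE t) => -[ht ->]; lra.
Qed.

(** The hat on [0, 2] with peak at 1; as it is a difference of clamps, sums of its integer
    translates telescope. *)
Definition tent (R : realType) (t : R) : R := clamp t - clamp (t - 1).

Lemma tent_ge0 (R : realType) (t : R) : 0 <= tent t.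
Proof. by rewrite subr_ge0; apply: ler_clamp; lra. Qed.

Lemma tent_supp (R : realType) (t : R) : tent t != 0 -> 0 <= t <= 2.
Proof.
apply: contra_neqT; rewrite negb_and -!ltNge => /orP[t0|t2]; rewrite /tent.
  by rewrite !clamp_le0 ?subrr //; lra.
by rewrite !clamp_ge1 ?subrr //; lra.
Qed.

Lemma c0_tent (R : realType) : c0 (@tent R).
Proof.
split.
- exists 1 => t; rewrite ger0_norm ?tent_ge0 // /tent.
  by have := clamp_le1 t; have := clamp_ge0 (t - 1); lra.
- move=> e e0; exists (e / 2) => [|x y xy]; first by lra.
  rewrite (_ : _ - _ = (clamp x - clamp y) - (clamp (x - 1) - clamp (y - 1))); last first.
    by rewrite /tent; ring.
  apply: (le_trans (ler_normB _ _)); have := clamp_lipschitz x y.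
  have := clamp_lipschitz (x - 1) (y - 1).
  by rewrite (_ : x - 1 - _ = x - y); [lra|ring].
- move=> e e0; exists 2 => // t t2; have [->|/tent_supp] := eqVneq (tent t) 0.
    by rewrite normr0 ltW.
  by move=> /andP[h1 h2]; move: t2; rewrite ger0_norm //; lra.
Qed.

Lemma sum_tent (R : realType) (t : R) (J : nat) :
  \sum_(j < J) tent (t - j%:R) = clamp t - clamp (t - J%:R).
Proof.
elim: J => [|J IH]; first by rewrite big_ord0 subr0 subrr.
rewrite big_ord_recr /= IH /tent -natr1.
by rewrite (_ : t - (J%:R + 1) = t - J%:R - 1); ring.
Qed.

Lemma prod_ge0_le1 (R : realType) (n : nat) (s : 'I_n -> R) :
  (forall i, 0 <= s i <= 1) -> 0 <= \prod_(i < n) s i <= 1.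
Proof.
move=> hs; apply/andP; split.
  by apply: prodr_ge0 => i _; case/andP: (hs i).
by apply: prodr_ile1 => i _; exact: hs.
Qed.

(** Products of tents over a grid of mesh [r] have sum at most 1 everywhere and exactly 1 on the
    cube [-L, L]^(n+1), so [h] is near their combination with coefficients [h (p k)]. *)
Lemma tensor_tent_approx (R : realType) (n : nat) (W : set ('rV[R]_n.+1 -> R)) :
  closed_subspace W ->
  (forall g (a : 'rV[R]_n.+1) (b : R), c0 g -> W (fun x => g (dot a x + b))) ->
  C0 R n.+1 `<=` W.
Proof.
move=> cW WR h hC.
pose A : set ('rV[R]_n.+1 -> R) := [set f | exists a (b : R), f = fun x => dot a x + b].
have AD f g (a b c : R) : A f -> A g -> A (fun x => a * f x + b * g x + c).
  move=> [u [s ->]] [v [t ->]].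
  exists (a *: u + b *: v), (a * s + b * t + c); apply/funext => x.
  have -> : dot (a *: u + b *: v) x = a * dot u x + b * dot v x.
    rewrite /dot !mulr_sumr -big_split /=; apply: eq_bigr => i _.
    by rewrite !mxE; ring.
  ring.
have WA g f : c0 g -> A f -> W (fun x => g (f x)).
  by move=> g0 [a [b ->]]; exact: WR.
have Acoord i (a b : R) : A (fun x => a * x ord0 i + b).
  exists (a *: delta_mx 0 i), b; apply/funext => x; congr (_ + _).
  rewrite /dot (bigD1 i) //= big1 => [|j ji]; last by rewrite !mxE (negbTE ji) andbF mulr0 mul0r.
  by rewrite !mxE !eqxx mulr1 addr0.
have Wprod (k : {ffun 'I_n.+1 -> nat}) (a b : R) :
    W (fun x => \prod_(i < n.+1) tent (a * x ord0 i + b - (k i)%:R)).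
  pose f (i : 'I_n.+1) (x : 'rV[R]_n.+1) := a * x ord0 i + (b - (k i)%:R).
  have Af i : A (f i) by exact: Acoord.
  (* The first [n] coordinates form a multiplier; the last one is the factor to which it is
     applied. *)
  have [_ WM] := multiplier_prod AD cW (index_enum 'I_n) (g := fun=> @tent R)
    (f := fun i => f (widen_ord (leqnSn n) i)) WA (fun=> c0_tent R) (fun i => Af _).
  have := WM _ _ (c0_tent R) (Af ord_max).
  congr W; apply/funext => x; rewrite big_ord_recr /= /f addrA; congr (_ * _).
  by apply: eq_bigr => i _; rewrite addrA.
apply: (closed_subspace_lim cW) => e e0; have e20 : 0 < e / 2 by lra.
have [d d0 hd] := C0_ucont hC e20; have [L L0 hL] := C0_vanishing hC e20.
pose r := d / 2; have r0 : 0 < r by rewrite /r; lra.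
(* As J r >= 2 L + r, the map [tau] sends coordinates in [-L, L] into [1, J], where the tents sum to
   1. *)
have [J J0 [hJ _]] := @exists_nat_mul_ge R (2 * L + r) 0 r r0.
pose tau (x : 'rV[R]_n.+1) i := r^-1 * x ord0 i + r^-1 * (L + r).
pose w (k : {ffun 'I_n.+1 -> 'I_J}) x := \prod_(i < n.+1) tent (tau x i - (k i)%:R).
(* [p k] is the lower corner of the support of [w k], a cube of side 2 r = d. *)
pose p (k : {ffun 'I_n.+1 -> 'I_J}) : 'rV[R]_n.+1 := \row_i (- (L + r) + r * (k i)%:R).
have sumw x : \sum_k w k x = \prod_(i < n.+1) (clamp (tau x i) - clamp (tau x i - J%:R)).
  rewrite /w -(bigA_distr_bigA (fun i (j : 'I_J) => tent (tau x i - j%:R))).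
  by apply: eq_bigr => i _; rewrite sum_tent.
have s01 x i : 0 <= clamp (tau x i) - clamp (tau x i - J%:R) <= 1.
  rewrite subr_ge0 ler_clamp /=; last by rewrite lerBlDr lerDl ler0n.
  by have := clamp_le1 (tau x i); have := clamp_ge0 (tau x i - J%:R); lra.
exists (fun x => \sum_k h (p k) * w k x) => [|x].
  apply: (closed_subspace_sum cW) => k; apply: (closed_subspaceZ cW).
  have := Wprod [ffun i => (k i : nat)] r^-1 (r^-1 * (L + r)).
  by congr W; apply/funext => x; apply: eq_bigr => i _; rewrite ffunE.
have /andP[sw0 sw1] := prod_ge0_le1 (s01 x).
have eE : e = 2 * (e / 2) + #|{ffun 'I_n.+1 -> 'I_J}|%:R * 0 by field.
rewrite {}eE; apply: (weighted_mean_error (ltW e20)).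
- by move=> k; apply: prodr_ge0 => i _; exact: tent_ge0.
- by rewrite sumw.
- rewrite sumw; have [xL|] := pselect (forall i, `|x ord0 i| <= L).
    rewrite (eq_bigr (fun=> 1)) => [|i _].
      by rewrite big1 // subrr mulr0 ltW.
    have := xL i; rewrite ler_norml => /andP[x1 x2].
    rewrite /tau -mulrDr clamp_ge1 ?clamp_le0 ?subr0 //.
      by rewrite subr_le0 mulrC ler_pdivrMr //; lra.
    by rewrite mulrC ler_pdivlMr //; lra.
  move=> /existsNP[i /negP]; rewrite -ltNge => /hL h1.
  by apply: le_trans h1; rewrite ler_piMr //; lra.
- move=> k; rewrite addr0; have [->|wk] := eqVneq (w k x) 0; first by rewrite !mul0r.
  rewrite ler_wpM2l //; first by apply: prodr_ge0 => i _; exact: tent_ge0.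
  apply: hd => i; have : tent (tau x i - (k i)%:R) != 0.
    apply: contra_neq wk => h0; rewrite /w (bigD1 i) //= h0 mul0r //.
  move=> /tent_supp /andP[h1 h2].
  rewrite (_ : _ - _ = r * (tau x i - (k i)%:R)); last first.
    by rewrite /tau mxE; field; rewrite gt_eqF.
  rewrite normrM (gtr0_norm r0) ger0_norm // (_ : d = r * 2) ?ler_pM2l //.
  by rewrite /r; field.
Qed.

(** For B > 0 a tent [T] of height [B] equals [t] on [0, B] and vanishes for t <= 0; its odd
    extension is the required function. *)
Lemma c0_id_near (R : realType) (B : R) : 0 <= B ->
  exists2 g : R -> R, c0 g & forall t, `|t| <= B -> g t = t.
Proof.
move=> B0; have [B0'|Bpos] := leP B 0.
  exists (fun=> 0) => [|t tB]; last first.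
    by apply/esym/eqP; rewrite -normr_le0; lra.
  have := c0B (c0_tent R) (c0_tent R).
  by congr c0; apply/funext => t; rewrite subrr.
pose T t := B * tent (t / B).
have T0 : c0 T.
  have [[C hC] uT vT] := c0_tent R; split.
  - exists (B * C) => t; rewrite normrM (gtr0_norm Bpos) ler_pM2l //.
  - move=> e e0; have [d d0 hd] := uT _ (divr_gt0 e0 Bpos).
    exists (d * B) => [|x y xy]; first exact: mulr_gt0.
    rewrite -mulrBr normrM (gtr0_norm Bpos) mulrC -ler_pdivlMr //; apply: hd.
    by rewrite -mulrBl normrM normfV (gtr0_norm Bpos) ler_pdivrMr.
  - move=> e e0; have [L L0 hL] := vT _ (divr_gt0 e0 Bpos).
    exists (L * B) => [|t tL]; first by rewrite mulr_ge0.
    rewrite normrM (gtr0_norm Bpos) mulrC -ler_pdivlMr //; apply: hL.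
    by rewrite normrM normfV (gtr0_norm Bpos) ltr_pdivlMr.
have TN0 : c0 (fun t => T (- t)).
  have [[C hC] uT vT] := T0; split; first by exists C => t.
  - move=> e /uT[d d0 hd]; exists d => // x y xy; apply: hd.
    by rewrite opprK addrC distrC.
  - by move=> e /vT[L L0 hL]; exists L => // t tL; apply: hL; rewrite normrN.
have Tpos t : 0 <= t <= B -> T t = t.
  move=> /andP[t0 tB]; rewrite /T /tent clamp_id; last first.
    by rewrite divr_ge0 //= ler_pdivrMr // mul1r.
  rewrite clamp_le0; last by rewrite subr_le0 ler_pdivrMr // mul1r.
  by rewrite subr0 mulrC divfK // gt_eqF.
have Tneg t : t <= 0 -> T t = 0.
  move=> t0; have tB : t / B <= 0 by rewrite mulr_le0_ge0 // invr_ge0 ltW.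
  by rewrite /T /tent !clamp_le0 ?subrr ?mulr0 //; lra.
exists (fun t => T t - T (- t)) => [|t]; first exact: c0B.
rewrite ler_norml => /andP[t1 t2]; have [t0|/ltW t0] := leP 0 t.
  by rewrite Tpos ?t0 // Tneg ?subr0 //; lra.
by rewrite (Tneg t) // Tpos ?sub0r ?opprK //; lra.
Qed.

(** * Induction on the layers and the equivalence *)

Lemma NN_S (R : realType) (phi : R -> R) (n l : nat) :
  NN phi n l.+2 = lin_span [set (fun x => phi (f x + b)) |
    f in NN phi n l.+1 & b in [set: R]].
Proof. by []. Qed.

Lemma C0_sub_NN (R : realType) (phi : R -> R) (n l : nat) :
  c0_generating phi -> C0 R n.+1 `<=` unif_closure (NN phi n.+1 l.+1).
Proof.
move=> gphi; elim: l => [|l IH].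
  apply: tensor_tent_approx; first exact: closed_subspace_unif_closure.
  move=> g a b g0.
  pose E : set ('rV[R]_n.+1 -> R) := [set f | exists a, f = dot a].
  have EZ f (c : R) : E f -> E (fun x => c * f x).
    move=> [u ->]; exists (c *: u); apply/funext => x.
    by rewrite /dot mulr_sumr; apply: eq_bigr => i _; rewrite !mxE mulrA.
  apply: (c0_generating_comp gphi (closed_subspace_unif_closure _) EZ) => //; last by exists a.
  move=> f c [u ->]; apply: sub_unif_closure; apply: sub_lin_span.
  by exists u => //; exists c.
move=> h hC; have [B hB] := C0_bdd hC.
have [g g0 gB] := c0_id_near (le_trans (normr_ge0 _) (hB 0)).
have cW : closed_subspace (unif_closure (NN phi n.+1 l.+2)).
  exact: closed_subspace_unif_closure.
have EZ f (a : R) : NN phi n.+1 l.+1 f -> NN phi n.+1 l.+1 (fun x => a * f x).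
  by case: l {IH cW} => [|l]; exact: lin_spanZ.
have WE f (b : R) : NN phi n.+1 l.+1 f ->
    unif_closure (NN phi n.+1 l.+2) (fun x => phi (f x + b)).
  move=> Ef; apply: sub_unif_closure; rewrite NN_S; apply: sub_lin_span.
  by exists f => //; exists b.
have hg x : h x = g (h x) by rewrite gB.
apply: (closed_subspace_lim cW) => e e0; have [_ ug _] := g0.
have [d d0 hd] := ug _ e0.
(* The values of [s] may leave [-B, B], but the uniform continuity of [g] keeps [g (s x)] near
   [g (h x)], which is [h x]. *)
have /unif_closureP /(_ _ d0) [s Es hs] := IH _ hC.
exists (fun x => g (s x + 0)) => [|x].
  exact: c0_generating_comp gphi cW EZ WE _ _ _ g0 Es.
by rewrite addr0 hg; exact: hd.
Qed.

(** A nonzero element of C_0(R), for the converse direction. *)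
Lemma C0_witch (R : realType) : C0 R 1 (fun x => witch (x ord0 ord0)).
Proof.
have [_ uw vw] := c0_witch R; split.
  move=> x; apply: (@continuous_comp _ _ _ (fun x : 'rV[R]_1 => x ord0 ord0) (@witch R)).
    exact: coord_continuous.
  exact: ucont_continuous.
move=> U /nbhs_ballP[e /= e0 eU]; have e20 : 0 < e / 2 by lra.
have [L L0 hL] := vw _ e20; exists L => // x Lx; apply: eU.
rewrite /ball /= sub0r normrN; apply: le_lt_trans (_ : e / 2 < e); last by lra.
apply: hL; move: Lx; rewrite /= /enorm /dot big_ord1 -expr2 sqrtr_sqr.
exact.
Qed.

Theorem theorem3p7 (R : realType) (phi : R -> R) :
  unif_closure (NN phi 1 1) `&` C0 R 1 <> [set (fun _ : 'rV[R]_1 => 0 : R)]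
  <->
  (forall n l : nat, (0 < n)%N -> (0 < l)%N ->
     C0 R n `<=` unif_closure (NN phi n l)).
Proof.
split=> [neq0 [|n] [|l] // _ _|dense].
  (* By contraposition: if [phi] is not generating, every [psi] in the intersection is 0, and 0
     always belongs to it. *)
  apply: C0_sub_NN; apply: contra_notP neq0 => ngen.
  apply/seteqP; split=> [psi [psiN psiC]|psi ->].
    by apply: contra_notP ngen => psi0; exact: c0_generating_of_closure psiN psiC psi0.
  split; first by case: (closed_subspace_unif_closure [set (fun x => phi (dot a x + b)) |
    a in [set: 'rV[R]_1] & b in [set: R]]).
  split; first exact: cst_continuous.
  by move=> U U0; exists 0 => // x _; exact: (nbhs_singleton U0).
(* Density for n = l = 1 puts [witch] into the intersection, which is then not reduced to 0. *)
move=> E; have : [set (fun _ : 'rV[R]_1 => 0 : R)] (fun x => witch (x ord0 ord0)).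
  by rewrite -E; split; [apply: dense => //|]; exact: C0_witch.
move=> /(congr1 (fun f => f 0)) /eqP; rewrite gt_eqF // witch_gt0 //.
Qed.
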